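(* Let $n$ be a positive odd integer, let $\Gamma=\mathbb{Z}/n\mathbb{Z}$ and let $\tau:\Gamma\to O(\mathbb{R}^2)$ send a generator to the rotation by $2\pi/n$ about the origin. A $\Gamma$-symmetric looped simple graph $(G,\phi)$ is $C_n$-isostatic if and only if it is $C_n$-tight.
   Context: A looped simple graph $G=(V,E,L)$ has a finite vertex set $V$, a set $E$ of edges, each an unordered pair $uw$ of distinct vertices (no multiple edges), and a finite set $L$ of loops, each incident to exactly one vertex (a vertex may carry several loops). $G$ is sparse if $|E'|+|L'|\le 2|V'|$ for every subgraph $(V',E',L')$ and $|E'|\le 2|V'|-3$ for every subgraph $(V',E',\emptyset)$ with $E'\ne\emptyset$; $G$ is tight if it is sparse and $|E|+|L|=2|V|$. For a finite group $\Gamma$, a $\Gamma$-symmetric graph is a pair $(G,\phi)$ with $\phi:\Gamma\to\mathrm{Aut}(G)$ a homomorphism, where an automorphism is a pair (permutation of $V$, permutation of $L$) preserving adjacency and vertex–loop incidence; write $\gamma v,\gamma l$ for images. $\gamma$ fixes a vertex $v$ if $\gamma v=v$, an edge $uw$ if ($\gamma u=u,\gamma w=w$) or ($\gamma u=w,\gamma w=u$), a loop $l$ if $\gamma l=l$; loops can only be fixed by elements of order $1$ or $2$. A linearly constrained framework $(G,p,q)$ in $\mathbb{R}^2$ consists of $G$, an injective $p:V\to\mathbb{R}^2$ and $q:L\to\mathbb{R}^2$. An infinitesimal motion is $\dot p:V\to\mathbb{R}^2$ with $(p(u)-p(w))\cdot(\dot p(u)-\dot p(w))=0$ for all $uw\in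 E$ and $q(l)\cdot\dot p(v)=0$ for each loop $l$ incident to $v$; the rigidity matrix $R(G,p,q)$ is the $(|E|+|L|)\times 2|V|$ coefficient matrix of this system. $(G,p,q)$ is isostatic if $\operatorname{rank}R(G,p,q)=2|V|$ and the rows of $R(G,p,q)$ are linearly independent. For a homomorphism $\tau:\Gamma\to O(\mathbb{R}^2)$, $(G,p,q)$ is $\Gamma$-symmetric (w.r.t. $\phi,\tau$) if $\tau(\gamma)p(v)=p(\gamma v)$ for all $v,\gamma$; $\tau(\gamma)q(l)=q(\gamma l)$ for all loops $l$ and all $\gamma$ of order not $2$; $\tau(\gamma)q(l)=-q(l)$ if $\tau(\gamma)$ is the half-turn and $\gamma$ fixes $l$; $\tau(\gamma)q(l)=\pm q(l)$ if $\tau(\gamma)$ is a reflection and $\gamma$ fixes $l$. $(G,\phi)$ is $\tau(\Gamma)$-isostatic if some $\Gamma$-symmetric framework $(G,p,q)$ is isostatic; for the $\tau$ of the claim this is called $C_n$-isostatic. For odd $n$, $(G,\phi)$ is $C_n$-tight if $G$ is tight and no non-identity element of $\Gamma$ fixes any vertex, edge or loop of $G$. *)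

(* Defs.v *)
(* MathComp world; the real numbers are an arbitrary [R : realType]. *)
From mathcomp Require Import all_boot all_order all_algebra all_fingroup.
From mathcomp Require Import all_solvable.
From mathcomp Require Import reals trigo.

Set Implicit Arguments.
Unset Strict Implicit.
Unset Printing Implicit Defensive.

Import GRing.Theory.
Local Open Scope ring_scope.

(* 'Z_n would be Z/2 for n = 1; 'I_n.-1.+1 with addition modulo n is Z/n for
   every n > 0, including the trivial group for n = 1. *)
Definition Zmod (n : nat) : finGroupType := 'I_n.-1.+1.

Record looped_graph := LoopedGraph {
  vertex : finType;
  loop : finType;
  edges : {set {set vertex}};
  edges_card2 : forall e, e \in edges -> #|e| = 2;
  loop_end : loop -> vertex
}.

Definition subgraph (G : looped_graph) (V' : {set vertex G})
    (E' : {set {set vertex G}}) (L' : {set loop G}) : Prop :=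
  [/\ E' \subset edges G,
      forall e, e \in E' -> e \subset V' &
      forall l, l \in L' -> loop_end l \in V'].

(* [#|E'| + 3 <= 2 * #|V'|] is |E'| <= 2|V'| - 3 without truncated
   subtraction. *)
Definition sparse (G : looped_graph) : Prop :=
  (forall (V' : {set vertex G}) (E' : {set {set vertex G}})
      (L' : {set loop G}),
     subgraph V' E' L' -> (#|E'| + #|L'| <= 2 * #|V'|)%N) /\
  (forall (V' : {set vertex G}) (E' : {set {set vertex G}}),
     subgraph V' E' set0 -> E' != set0 -> (#|E'| + 3 <= 2 * #|V'|)%N).

Definition tight (G : looped_graph) : Prop :=
  sparse G /\ (#|edges G| + #|loop G| = 2 * #|vertex G|)%N.

Definition is_automorphism (G : looped_graph) (s : {perm vertex G})
    (t : {perm loop G}) : Prop :=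
  (forall u w, ([set s u; s w] \in edges G) = ([set u; w] \in edges G)) /\
  (forall l, loop_end (t l) = s (loop_end l)).

(* A homomorphism gT -> Aut(G) for left actions. It is spelled out pointwise
   because the product of {perm T} composes in the opposite order. *)
Record graph_symmetry (gT : finGroupType) (G : looped_graph) :=
  GraphSymmetry {
    actV : gT -> {perm vertex G};
    actL : gT -> {perm loop G};
    act_aut : forall a, is_automorphism (actV a) (actL a);
    actVM : forall a b v, actV (a * b)%g v = actV a (actV b v);
    actLM : forall a b l, actL (a * b)%g l = actL a (actL b l)
  }.

Section Symmetry.
Variables (gT : finGroupType) (G : looped_graph) (phi : graph_symmetry gT G).

Definition fixes_vertex (a : gT) (v : vertex G) : Prop := actV phi a v = v.

Definition fixes_edge (a : gT) (u w : vertex G) : Prop :=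
  (actV phi a u = u /\ actV phi a w = w) \/
  (actV phi a u = w /\ actV phi a w = u).

Definition fixes_loop (a : gT) (l : loop G) : Prop := actL phi a l = l.

(* C_n-tightness; this form is meant for gT cyclic of odd order n. *)
Definition Cn_odd_tight : Prop :=
  tight G /\
  forall a : gT, a != 1%g ->
    [/\ forall v, ~ fixes_vertex a v,
        forall u w, [set u; w] \in edges G -> ~ fixes_edge a u w &
        forall l, ~ fixes_loop a l].
End Symmetry.

Definition dot (R : realType) (x y : 'cV[R]_2) : R :=
  \sum_(k < 2) x k 0 * y k 0.

Section Framework.
Variables (R : realType) (G : looped_graph).
Variables (p : vertex G -> 'cV[R]_2) (q : loop G -> 'cV[R]_2).

Definition infinitesimal_motion (dp : vertex G -> 'cV[R]_2) : Prop :=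
  (forall u w, [set u; w] \in edges G -> dot (p u - p w) (dp u - dp w) = 0) /\
  (forall l, dot (q l) (dp (loop_end l)) = 0).

(* The coefficient of dp v in the equation of the edge e = {u, w} is p u - p w
   if v = u, p w - p u if v = w, and 0 otherwise. *)
Definition edge_coef (e : {set vertex G}) (v : vertex G) : 'cV[R]_2 :=
  if v \in e then \sum_(w in e) (p v - p w) else 0.

Definition loop_coef (l : loop G) (v : vertex G) : 'cV[R]_2 :=
  if v == loop_end l then q l else 0.

(* Vectors of R^(2|V|) are flattened |V| x 2 matrices. *)
Definition flatten_vertices (c : vertex G -> 'cV[R]_2) :
    'rV[R]_(#|vertex G| * 2) :=
  mxvec (\matrix_(i < #|vertex G|, k < 2) c (enum_val i) k 0).

Definition rigidity_matrix :
    'M[R]_(#|edges G| + #|loop G|, #|vertex G| * 2) :=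
  col_mx (\matrix_(i < #|edges G|) flatten_vertices (edge_coef (enum_val i)))
         (\matrix_(i < #|loop G|) flatten_vertices (loop_coef (enum_val i))).

Definition isostatic : Prop :=
  \rank rigidity_matrix = (2 * #|vertex G|)%N /\ row_free rigidity_matrix.

Lemma flatten_dot (c d : vertex G -> 'cV[R]_2) :
  flatten_vertices c *m (flatten_vertices d)^T =
  (\sum_v dot (c v) (d v))%:M.
Proof.
apply/matrixP=> i j; rewrite !ord1 !mxE eqxx mulr1n.
rewrite (reindex _ (curry_mxvec_bij _ _)) /=.
rewrite (reindex (@enum_val _ (mem (vertex G)))) /=; last first.
  by exists enum_rank => x _; [exact: enum_valK | exact: enum_rankK].
rewrite pair_bigA /=; apply: eq_bigr => -[x k] _ /=.
by rewrite mxE !mxvecE !mxE.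
Qed.

Lemma edge_coefE (dp : vertex G -> 'cV[R]_2) (u w : vertex G) : u != w ->
  \sum_v dot (edge_coef [set u; w] v) (dp v) = dot (p u - p w) (dp u - dp w).
Proof.
move=> uw; rewrite (bigD1 u) //= (bigD1 w) ?[w == u]eq_sym //=.
rewrite big1 => [|v /andP[vu vw]]; last first.
  rewrite /edge_coef !inE (negPf vu) (negPf vw) /= /dot big1 // => k _.
  by rewrite mxE mul0r.
rewrite addr0 /edge_coef !inE !eqxx orbT /= !big_setU1 ?inE //= !big_set1.
rewrite !subrr add0r addr0 /dot -big_split /=; apply: eq_bigr => k _.
by rewrite !mxE mulrBr -[p w k 0 - p u k 0]opprB mulNr.
Qed.

Lemma rigidity_matrixP (dp : vertex G -> 'cV[R]_2) :
  infinitesimal_motion dp <->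
  rigidity_matrix *m (flatten_vertices dp)^T = 0.
Proof.
have loopE l : \sum_v dot (loop_coef l v) (dp v) = dot (q l) (dp (loop_end l)).
  rewrite (bigD1 (loop_end l)) //= {1}/loop_coef eqxx big1 ?addr0 // => v vl.
  by rewrite /loop_coef (negPf vl) /dot big1 // => k _; rewrite mxE mul0r.
have rowE m (F : 'I_m -> vertex G -> 'cV[R]_2) :
  (\matrix_i flatten_vertices (F i)) *m (flatten_vertices dp)^T =
  \col_i \sum_v dot (F i v) (dp v).
  apply/row_matrixP => i; rewrite row_mul rowK flatten_dot.
  by apply/matrixP => a b; rewrite !ord1 !mxE eqxx mulr1n.
rewrite /rigidity_matrix mul_col_mx !rowE -col_mx0.
split=> [[He Hl]|/eq_col_mx[He Hl]].
  congr col_mx; apply/matrixP => i j; rewrite !mxE; last first.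
    by rewrite loopE Hl.
  have eE := enum_valP i; have /eqP := edges_card2 eE.
  case/cards2P=> u [w] [uw euw].
  by rewrite euw edge_coefE // He // -euw.
split=> [u w uwE | l].
  have uw : u != w.
    by have := edges_card2 uwE; rewrite cards2; case: (u != w).
  move/matrixP/(_ (enum_rank_in uwE [set u; w]) 0): He.
  by rewrite !mxE enum_rankK_in // edge_coefE.
move/matrixP/(_ (enum_rank l) 0): Hl.
by rewrite !mxE enum_rankK loopE.
Qed.
End Framework.

Definition orthogonal_rep (R : realType) (gT : finGroupType)
    (tau : gT -> 'M[R]_2) : Prop :=
  (forall a, tau a *m (tau a)^T = 1%:M) /\
  (forall a b, tau (a * b)%g = tau a *m tau b).

Definition rotation (R : realType) (t : R) : 'M[R]_2 :=
  \matrix_(i < 2, j < 2)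
    if i == j then cos t else if i == 0 then - sin t else sin t.

Definition is_half_turn (R : realType) (A : 'M[R]_2) : Prop := A = - 1%:M.

Definition is_reflection (R : realType) (A : 'M[R]_2) : Prop :=
  A *m A^T = 1%:M /\ \det A = -1.

Definition symmetric_framework (R : realType) (gT : finGroupType)
    (tau : gT -> 'M[R]_2) (G : looped_graph) (phi : graph_symmetry gT G)
    (p : vertex G -> 'cV[R]_2) (q : loop G -> 'cV[R]_2) : Prop :=
  [/\ forall a v, tau a *m p v = p (actV phi a v),
      forall a l, #[a]%g <> 2 -> tau a *m q l = q (actL phi a l),
      forall a l, is_half_turn (tau a) -> fixes_loop phi a l ->
        tau a *m q l = - q l &
      forall a l, is_reflection (tau a) -> fixes_loop phi a l ->
        tau a *m q l = q l \/ tau a *m q l = - q l].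

Definition symmetric_isostatic (R : realType) (gT : finGroupType)
    (tau : gT -> 'M[R]_2) (G : looped_graph) (phi : graph_symmetry gT G) :
    Prop :=
  exists (p : vertex G -> 'cV[R]_2) (q : loop G -> 'cV[R]_2),
    [/\ injective p, symmetric_framework tau phi p q & isostatic p q].

(* Main.v *)
(* Necessity. In an isostatic framework the rows indexed by any set of edges
   and loops are independent, while the displacements vanishing on V', together
   with the infinitesimal isometries when only edges are involved, are killed by
   the rows supported on V'; this gives sparsity. A non-trivial rotation fixes
   only the origin, so a fixed loop would have q(l) = 0 and a fixed edge would
   contradict the injectivity of p. If a vertex were fixed by a <> 1, it would be
   the only one, and <a> would act freely on the other vertices, on the edges and
   on the loops; then the odd order of a would divide 2|V| - 2(|V| - 1) = 2.

   Sufficiency. No inductive construction is used. Choose a direction (1, t) for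
   each orbit of edges and of loops and extend it equivariantly. Over C the
   motions split into the spaces W_k of twisted displacements
   x(gv) = w^k tau(g) x(v), so it is enough to have only the zero solution in
   each W_k, where there are as many orbits of constraints as dimensions. By
   Rado's theorem generic t do this as soon as
   |E'| + |L'| + n dim K <= 2|V| for the space K of elements of W_k that are
   constant along an invariant set E' and zero on L'. The bound is checked on each
   connected class modulo the group according to dim ev_y(K) in {0, 1, 2}: the
   values 0 and 1 use sparsity and divisibility by n, and the value 2 forces the
   class to split into n disjoint translates of a component, as tau(a) is not
   scalar for a <> 1 when n is odd.
   It remains to find an equivariant injective p such that p(u) - p(w) is parallel
   to the direction chosen for uw. For every pair u <> w the corresponding count
   with the extra condition x(u) = x(w) is stronger by n, so by the same theorem
   some solution in W_0 separates u from w; a generic combination of these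
   solutions is injective. *)

From HB Require Import structures.
Require Import Defs.
From mathcomp Require Import all_boot all_order all_algebra all_fingroup.
From mathcomp Require Import all_solvable.
From mathcomp Require Import reals trigo.
From mathcomp Require Import separable cyclotomic complex zify ring.

Set Implicit Arguments.
Unset Strict Implicit.
Unset Printing Implicit Defensive.

Import Order.TTheory GRing.Theory Num.Theory.
Local Open Scope ring_scope.

(** * A simultaneous Rado theorem *)

Lemma memv_bigcapP (F : fieldType) (U : vectType F) (I : finType)
    (P : pred I) (X : I -> {vspace U}) (x : U) :
  reflect (forall i, P i -> x \in X i) (x \in \bigcap_(i | P i) X i)%VS.
Proof.
by rewrite memvE; apply: (iffP subv_bigcapP) => xX i /xX; rewrite memvE.
Qed.

(** Genericity is made finite here: parameters are natural numbers, and each condition on them will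
    be shown to exclude at most one value. *)
Lemma eventually_avoid (K : eqType) (ks : seq K) (bad : K -> nat -> Prop) :
    (forall k, k \in ks -> forall i j, bad k i -> bad k j -> i = j) ->
  exists N, forall i, (N <= i)%N -> forall k, k \in ks -> ~ bad k i.
Proof.
elim: ks => [|k ks IHks] bad1; first by exists 0%N.
have [l lks|N badN] := IHks; first by apply: bad1; rewrite inE lks orbT.
case: (boolp.pselect (exists i, bad k i)) => [[i badi]|nbad].
  exists (maxn N i.+1) => j; rewrite geq_max => /andP[Nj ij] l.
  rewrite inE => /predU1P[->|/badN]; last exact.
  by move=> /(bad1 _ (mem_head _ _) _ _ badi) eij; rewrite eij ltnn in ij.
exists N => j Nj l; rewrite inE => /predU1P[->|/badN]; last exact.
by move=> badj; apply: nbad; exists j.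
Qed.

Section Transversals.
Variables (F : fieldType) (U : vectType F).
Implicit Types (B : {vspace U}) (c : nat).

(** With [c = \dim B] this is Rado's condition for choosing, in the annihilator of each [N i], a
    linear form so that the chosen forms are independent on [B]. *)
Definition hall (I : finType) (J : {set I}) B c (N : I -> {vspace U}) :=
  forall A : {set I}, A \subset J ->
    (#|A| + \dim (B :&: \bigcap_(i in A) N i) <= c)%N.

(* Violating sets for [Y] and for [Z] would, by modularity of the dimension,
   have a union or an intersection violating the condition for [N]. *)
Lemma hall_shrink (I : finType) (J : {set I}) B c (N : I -> {vspace U})
    (e : I) (Y Z : {vspace U}) :
    hall J B c N -> (Y :&: Z <= N e)%VS -> (N e <= Y)%VS -> (N e <= Z)%VS ->
  hall J B c (fun i => if i == e then Y else N i) \/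
  hall J B c (fun i => if i == e then Z else N i).
Proof.
move=> hN YZ NY NZ; apply: boolp.contrapT => /boolp.not_orP[].
move=> /boolp.existsNP[A1 /boolp.not_implyP[A1J /negP]].
rewrite -ltnNge => A1big.
move=> /boolp.existsNP[A2 /boolp.not_implyP[A2J /negP]].
rewrite -ltnNge => A2big.
have inA (X : {vspace U}) (A : {set I}) : A \subset J ->
    (c < #|A| + \dim (B :&: \bigcap_(i in A) (if i == e then X else N i)))%N ->
    e \in A.
  move=> AJ; apply: contraLR => eA; rewrite -leqNgt.
  rewrite (eq_bigr N) => [|i iA]; first exact: hN.
  by rewrite (negPf (memPn eA i iA)).
have eA1 := inA _ _ A1J A1big; have eA2 := inA _ _ A2J A2big.
set P1 := (B :&: _)%VS in A1big; set P2 := (B :&: _)%VS in A2big.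
(* On [P1 :&: P2] both [Y] and [Z] hold at [e], hence so does [N e]. *)
have hU : (#|A1 :|: A2| + \dim (P1 :&: P2) <= c)%N.
  apply: leq_trans (hN (A1 :|: A2) _); last by rewrite subUset A1J.
  rewrite leq_add2l dimvS //; apply/subvP => x.
  rewrite !memv_cap => /andP[/andP[xB /memv_bigcapP x1]].
  move=> /andP[_ /memv_bigcapP x2]; rewrite xB /=; apply/memv_bigcapP => i.
  rewrite inE => iA; case: (eqVneq i e) => [->|ie].
    move: (x1 e eA1) (x2 e eA2); rewrite eqxx => xY xZ.
    by apply: (subvP YZ); rewrite memv_cap xY.
  by case/orP: iA => [/x1|/x2]; rewrite (negPf ie).
(* At [e] the sum only lies in [Y + Z], so [e] is dropped; the two strict violations leave room for
   this loss of one. *)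
have hI : (#|(A1 :&: A2) :\ e| + \dim (P1 + P2) <= c)%N.
  apply: leq_trans (hN ((A1 :&: A2) :\ e) _); last first.
    by rewrite (subset_trans (subD1set _ _)) // (subset_trans (subsetIl _ _)).
  rewrite leq_add2l dimvS // subv_add !subv_cap !capvSl /=.
  apply/andP; split; apply/subv_bigcapP => i; rewrite !inE;
    move=> /and3P[ie i1 i2]; apply: (subv_trans (capvSr _ _)).
    by apply: (bigcapv_inf i) => //; rewrite (negPf ie).
  by apply: (bigcapv_inf i) => //; rewrite (negPf ie).
have := dimv_sum_cap P1 P2; have := cardsUI A1 A2.
have := cardsD1 e (A1 :&: A2); rewrite inE eA1 eA2 /=.
lia.
Qed.

(* A dual, simultaneous form of Rado's theorem: each condition [k] excludes at
   most one value of the parameter of each line [X k i]. *)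
Lemma generic_transversal (K : eqType) (ks : seq K) (I : finType)
    (J : K -> {set I}) (B : K -> {vspace U}) (c : K -> nat)
    (N : K -> I -> {vspace U}) (X : K -> I -> nat -> {vspace U}) :
    (forall k i s, (N k i <= X k i s)%VS) ->
    (forall k i s t, s != t -> (X k i s :&: X k i t <= N k i)%VS) ->
    (forall k, k \in ks -> hall (J k) (B k) (c k) (N k)) ->
  exists t : I -> nat, forall k, k \in ks ->
    (#|J k| + \dim (B k :&: \bigcap_(i in J k) X k i (t i)) <= c k)%N.
Proof.
move=> NX XX hN.
(* Indices are treated one at a time: those already treated carry their chosen space, the others
   still carry [N]. *)
suff [t ht] : exists t : I -> nat, forall k, k \in ks ->
    hall (J k) (B k) (c k)
      (fun i => if i \in enum I then X k i (t i) else N k i).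
  exists t => k kks; apply: leq_trans (ht k kks _ (subxx _)).
  by under [X in (_ <= _ + \dim (_ :&: X))%N]eq_bigr do rewrite mem_enum.
elim: (enum I) => [|e s [t ht]]; first by exists (fun=> 0%N).
have [es|es] := boolP (e \in s).
  exists t => k kks A AJ; apply: leq_trans (ht k kks _ AJ).
  rewrite leq_eqVlt (eq_bigr (fun i => if i \in s then X k i (t i) else N k i)).
    by rewrite eqxx.
  by move=> i _; rewrite inE; case: eqP => // ->; rewrite es.
pose Y k i a := if i \in s then X k i (t i) else
  if i == e then X k i a else N k i.
(* Two bad values for the same [k] would contradict [hall_shrink], since the two spaces meet inside
   [N k e]. *)
have [k kks a b|m bad] := @eventually_avoid K ks
    (fun k a => ~ hall (J k) (B k) (c k) (fun i => Y k i a)).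
  move=> na nb; apply/eqP; apply: boolp.contrapT => /negP ab.
  pose M i := if i \in s then X k i (t i) else N k i.
  have := @hall_shrink I (J k) (B k) (c k) M e (X k e a) (X k e b) (ht k kks).
  rewrite {1 2 3}/M (negPf es) => /(_ (XX _ _ _ _ ab) (NX _ _ _) (NX _ _ _)).
  have YE d : (fun i => if i == e then X k e d else M i) = Y k ^~ d.
    apply: boolp.funext => i; rewrite /Y /M.
    by case: eqP => // ->; rewrite (negPf es).
  by rewrite !YE => -[].
exists (fun i => if i == e then m else t i) => k kks.
have /boolp.contrapT := bad m (leqnn _) k kks.
congr (hall _ _ _ _); apply: boolp.funext => i; rewrite /Y inE.
case: eqP => [->|_]; rewrite ?(negPf es) //=.
Qed.

Lemma dim_capv_functionals (I : finType) (W : vectType F) (P : pred I)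
    (h : I -> 'Hom(U, W)) (B : {vspace U}) :
  (\dim B <= \dim (B :&: \bigcap_(i | P i) lker (h i)) + dim W * #|P|)%N.
Proof.
rewrite -sum1_card big_distrr /= muln1.
elim/big_rec2: _ => [|i m X _ IH]; first by rewrite capvf addn0.
apply: leq_trans IH _; rewrite addnCA addnA leq_add2r.
rewrite (capvC (lker _)) capvA -(limg_ker_dim (h i) (B :&: X)) addnC leq_add2r.
by rewrite -(dimvf W) dimvS ?subvf.
Qed.

End Transversals.

(** * Free actions *)

(** [T] holds one point per orbit in [Y], [r] sends a point to its representative and [cf] gives the
    group element leading back. The last clause measures unions of orbits, which are free. *)
Definition free_transversal (gT : finGroupType) (S : finType)
    (act : gT -> S -> S) (Y T : {set S}) (r : S -> S) (cf : S -> gT) :=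
  [/\ T \subset Y,
      forall s, s \in Y -> r s \in T /\ s = act (cf s) (r s),
      forall a s, s \in Y -> r (act a s) = r s /\ cf (act a s) = (a * cf s)%g,
      forall t, t \in T -> r t = t /\ cf t = 1%g &
      forall A : {set S}, A \subset T ->
        #|[set s in Y | r s \in A]| = (#|gT| * #|A|)%N].

Section FreeActions.
Variables (gT : finGroupType) (S : finType) (act : gT -> S -> S).
Hypothesis act1 : forall s, act 1%g s = s.
Hypothesis actM : forall a b s, act (a * b)%g s = act a (act b s).

Lemma left_actK a : cancel (act a) (act a^-1%g).
Proof. by move=> s; rewrite -actM mulVg act1. Qed.

Lemma left_actVK a : cancel (act a^-1%g) (act a).
Proof. by move=> s; rewrite -actM mulgV act1. Qed.

(** The orbit theory used below is stated for right actions, hence the inverse. *)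
Let right_act s a := act a^-1%g s.

Let right_act1 s : right_act s 1%g = s.
Proof. by rewrite /right_act invg1. Qed.

Let right_actM s : act_morph right_act s.
Proof. by move=> a b; rewrite /right_act invMg actM. Qed.

Let to := TotalAction right_act1 right_actM.

Lemma free_action_dvdn (H : {group gT}) (Y : {set S}) :
    (forall a s, a \in H -> s \in Y -> act a s \in Y) ->
    (forall a s, a \in H -> s \in Y -> act a s = s -> a = 1%g) ->
  (#|H| %| #|Y|)%N.
Proof.
move=> stabY freeY.
have actsY : [acts H, on Y | to].
  apply/actsP => a aH s; apply/idP/idP => [sY|]; last first.
    by apply: stabY; rewrite groupV.
  by rewrite -[s](left_actVK a); apply: stabY.
rewrite -(acts_sum_card_orbit actsY); apply: dvdn_sum => _ /imsetP[s sY ->].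
rewrite card_orbit.
suff -> : 'C_H[s | to]%g = 1%G by rewrite indexg1.
apply/trivgP/subsetP => a; rewrite inE => /andP[aH /astab1P].
move=> sa; rewrite inE -eq_invg1; apply/eqP.
by apply: (freeY _ s) => //; rewrite groupV.
Qed.

Lemma free_action_transversal (Y : {set S}) :
    (forall a s, s \in Y -> act a s \in Y) ->
    (forall a s, s \in Y -> act a s = s -> a = 1%g) ->
  exists T r cf, free_transversal act Y T r cf.
Proof.
move=> stabY freeY.
(* [pick] sees only the orbit as a set, so [r] is constant on orbits. *)
pose r s := odflt s [pick t in orbit to [set: gT] s].
pose cf s := odflt 1%g [pick a | act a (r s) == s].
have rE s : exists a, s = act a (r s).
  rewrite /r; case: pickP => [t|/(_ s)]; last by rewrite /= orbit_refl.
  by move=> /orbitP[a _ <-] /=; exists a; rewrite /= /right_act left_actVK.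
have cfE s : act (cf s) (r s) = s.
  rewrite /cf; case: pickP => [a /eqP //|no]; have [a sa] := rE s.
  by have := no a; rewrite -sa eqxx.
have rA a s : r (act a s) = r s.
  have orbE : orbit to [set: gT] (act a s) = orbit to [set: gT] s.
    apply/esym/orbit_eqP/orbitP; exists a => //=.
    by rewrite /right_act left_actK.
  rewrite /r orbE; case: pickP => [//|/(_ s)]; by rewrite orbit_refl.
have rY s : s \in Y -> r s \in Y.
  by move=> sY; rewrite -[r s](left_actK (cf s)) cfE stabY.
have rr s : r (r s) = r s by rewrite -{2}(cfE s) rA.
have freeP a b s : s \in Y -> act a s = act b s -> a = b.
  move=> sY ab; apply/esym/eqP; rewrite eq_mulVg1; apply/eqP.
  by apply: (freeY _ s) => //; rewrite actM ab left_actK.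
exists [set s in Y | r s == s], r, cf; split.
- by apply/subsetP => s; rewrite inE => /andP[].
- by move=> s sY; rewrite inE rY // rr eqxx cfE.
- move=> a s sY; split=> //; apply: (freeP _ _ (r s)); first exact: rY.
  by rewrite actM cfE -{1}(rA a s) cfE.
- move=> t; rewrite inE => /andP[tY /eqP rt]; split=> //.
  by apply: (freeY _ t tY); rewrite -{2}rt cfE.
move=> A AT; have AP s : s \in A -> s \in Y /\ r s = s.
  by move=> /(subsetP AT); rewrite inE => /andP[? /eqP].
rewrite mulnC -[#|gT|]cardsT -cardsX -(@card_in_imset _ _ (fun p => act p.2 p.1)).
  apply: eq_card => s; rewrite inE; apply/andP/imsetP => [[sY sA]|[[t a]]].
    by exists (r s, cf s); rewrite ?cfE // !inE sA.
  rewrite !inE /= andbT => tA ->; have [tY rt] := AP t tA.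
  by rewrite stabY // rA rt.
move=> [s a] [t b]; rewrite !inE /= !andbT => /AP[sY rs] /AP[tY rt] st.
have est : s = t by rewrite -rs -rt -(rA a s) st rA.
by rewrite est in st *; rewrite (freeP _ _ _ tY st).
Qed.

End FreeActions.

(** * Roots of unity and eigenvectors *)

Lemma closed_prim_root_exists (C : numClosedFieldType) (n : nat) :
  (n > 0)%N -> exists z : C, n.-primitive_root z.
Proof.
pose p : {poly C} := 'X^n - 1; have [r Dp] := closed_field_poly_normal p.
move=> n_gt0; rewrite (monicP _) ?monicXnsubC // scale1r in Dp.
have rn1 : all n.-unity_root r by apply/allP=> z; rewrite -root_prod_XsubC -Dp.
have sz_r : (n < (size r).+1)%N.
  by rewrite -(size_prod_XsubC r id) -Dp size_XnsubC.
have [|z] := hasP (has_prim_root n_gt0 rn1 _ sz_r); last by exists z.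
rewrite -separable_prod_XsubC -Dp separable_Xn_sub_1 //.
by rewrite pnatr_eq0 -lt0n.
Qed.

(** A vector of finite period under [T] splits into eigenvectors by the discrete Fourier transform;
    [P] plays the part of an invariant subspace. *)
Lemma eigenvector_exists (F : numFieldType) (n : nat) (w : F)
    (U : lmodType F) (T : {linear U -> U}) (P : U -> Prop) (x : U) :
    n.-primitive_root w ->
    (forall y z a, P y -> P z -> P (y + a *: z)) ->
    (forall y, P y -> P (T y)) ->
    iter n T x = x -> P x -> x != 0 ->
  exists (j : 'I_n) (y : U), [/\ P y, y != 0 & T y = w ^+ j *: y].
Proof.
move=> w_prim PD PT Tnx Px /eqP x0; apply: boolp.contrapT => noeig; apply: x0.
have n_gt0 := prim_order_gt0 w_prim.
have w_neq0 : w != 0.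
  apply/eqP => w0; have /eqP := prim_expr_order w_prim.
  by rewrite w0 expr0n gtn_eqF // eq_sym oner_eq0.
(* The Fourier component of [x] for the eigenvalue [w ^+ j]. *)
pose y j := \sum_(k < n) (w ^+ j) ^- k *: iter k T x.
have Py j : P (y j).
  have P0 : P 0 by have := PD _ _ (-1) Px Px; rewrite scaleN1r subrr.
  rewrite /y; elim/big_ind: _ => // [u v Pu Pv|k _].
    by have := PD _ _ 1 Pu Pv; rewrite scale1r.
  rewrite -[X in P X]add0r; apply: PD => //.
  by elim: (k : nat) => //= m; apply: PT.
have Ty j : T (y j) = w ^+ j *: y j.
  have wj0 : w ^+ j != 0 by rewrite expf_neq0.
  rewrite /y linear_sum scaler_sumr /= -(prednK n_gt0).
  rewrite big_ord_recr [RHS]big_ord_recl /= addrC; congr (_ + _).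
    rewrite linearZ /= -iterS prednK // Tnx expr0 invr1 scale1r.
    congr (_ *: _); apply: (mulIf (expf_neq0 n.-1 wj0)); rewrite mulVf ?expf_neq0 //.
    by rewrite -exprS prednK // exprAC (prim_expr_order w_prim) expr1n.
  apply: eq_bigr => k _; rewrite linearZ /= scalerA; congr (_ *: _).
  by rewrite exprS invfM mulVKf.
have y0 (j : 'I_n) : y j = 0.
  by apply/eqP; apply: boolp.contrapT => /negP yj; apply: noeig; exists j, (y j).
(* Summing the components gives [n] times [x], because the geometric sums for [k != 0] vanish; so
   [x] is zero if every component is. *)
have : \sum_(j < n) y j = 0 by apply: big1 => j _.
rewrite exchange_big /= (bigD1 (Ordinal n_gt0)) //= [X in _ + X]big1 => [|k k0].
  rewrite addr0 (eq_bigr (fun=> x)) => [|j _]; last first.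
    by rewrite expr0 invr1 scale1r.
  rewrite sumr_const card_ord -scaler_nat => /eqP.
  by rewrite scaler_eq0 pnatr_eq0 gtn_eqF //= => /eqP.
rewrite -scaler_suml (eq_bigr (fun j : 'I_n => (w ^- k) ^+ j)) => [|j _]; last first.
  by rewrite exprVn exprAC.
have /eqP := subrX1 (w ^- k) n; rewrite exprVn exprAC (prim_expr_order w_prim).
rewrite expr1n invr1 subrr eq_sym mulf_eq0 subr_eq0 => /orP[|/eqP->].
  rewrite invr_eq1 -(prim_order_dvd w_prim) => /dvdn_leq.
  by rewrite lt0n => /(_ k0); rewrite leqNgt ltn_ord.
by rewrite scale0r.
Qed.

(** * Evaluation of displacement fields at vertices *)

Section Evaluation.
Variables (F : fieldType) (V : finType).

Definition ffun_at (v : V) (x : {ffun V -> 'cV[F]_2}) : 'cV[F]_2 := x v.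

Fact ffun_at_is_linear v : linear (ffun_at v).
Proof. by move=> a x y; rewrite /ffun_at !ffunE. Qed.

HB.instance Definition _ v :=
  GRing.isLinear.Build F {ffun V -> 'cV[F]_2} 'cV[F]_2 *:%R (ffun_at v)
    (ffun_at_is_linear v).

Definition ev (v : V) : 'Hom({ffun V -> 'cV[F]_2}, 'cV[F]_2) :=
  linfun (ffun_at v).

Lemma evE v x : ev v x = x v.
Proof. by rewrite lfunE. Qed.

Definition ev_sub (u w : V) : 'Hom({ffun V -> 'cV[F]_2}, 'cV[F]_2) :=
  ev u - ev w.

Lemma ev_subE u w x : ev_sub u w x = x u - x w.
Proof. by rewrite add_lfunE opp_lfunE !evE. Qed.

(** Evaluate at the vertices of [s] in turn: each step passes to the kernel and loses the dimension
    of an image, and the last kernel is zero. *)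
Lemma dim_le_sum_ev (K : {vspace {ffun V -> 'cV[F]_2}}) (s : seq V) :
    (forall x, x \in K -> (forall v, v \in s -> x v = 0) -> x = 0) ->
  (\dim K <= \sum_(v <- s) \dim (ev v @: K))%N.
Proof.
elim: s K => [|v s IHs] K K0.
  rewrite big_nil leqn0 dimv_eq0 -subv0; apply/subvP => x xK.
  by rewrite (K0 x xK) ?mem0v.
rewrite big_cons -(limg_ker_dim (ev v) K) addnC leq_add2l.
apply: leq_trans (IHs _ _) _ => [x|].
  rewrite memv_cap memv_ker evE => /andP[xK /eqP xv] xs.
  by apply: K0 => // u; rewrite inE => /predU1P[->|/xs].
by apply: leq_sum => u _; rewrite dimvS // limgS // capvSl.
Qed.

End Evaluation.
Arguments ev {F V} v.
Arguments ev_sub {F V} u w.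

(** * Counting in a symmetric sparse graph *)

Lemma set2_eq (T : finType) (a b u w : T) :
  [set a; b] = [set u; w] -> (a = u /\ b = w) \/ (a = w /\ b = u).
Proof.
move=> /setP E; move: (E a) (E b) (E u) (E w).
rewrite !inE !eqxx !orbT /= => /esym/orP[]/eqP-> /esym/orP[]/eqP->;
  rewrite ?eqxx ?orbb ?orbT; try by move=> *; auto.
  by move=> _ /eqP->; auto.
by move=> /eqP-> _; auto.
Qed.

Lemma edgeP (G : looped_graph) (f : {set vertex G}) :
  f \in edges G -> exists u w, u != w /\ f = [set u; w].
Proof.
by move=> /edges_card2/eqP/cards2P[u [w [uw ->]]]; exists u, w.
Qed.

(** * The group action on edges and free symmetries *)

Section Symmetry.
Variables (gT : finGroupType) (G : looped_graph) (phi : graph_symmetry gT G).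

Lemma actV1 v : actV phi 1%g v = v.
Proof. by apply: (@perm_inj _ (actV phi 1%g)); rewrite -actVM mulg1. Qed.

Lemma actV_K a : cancel (actV phi a) (actV phi a^-1%g).
Proof. by move=> v; rewrite -actVM mulVg actV1. Qed.

Lemma actV_VK a : cancel (actV phi a^-1%g) (actV phi a).
Proof. by move=> v; rewrite -actVM mulgV actV1. Qed.

Lemma actL1 l : actL phi 1%g l = l.
Proof. by apply: (@perm_inj _ (actL phi 1%g)); rewrite -actLM mulg1. Qed.

Definition actE (a : gT) (f : {set vertex G}) : {set vertex G} :=
  actV phi a @: f.

Lemma actE1 f : actE 1%g f = f.
Proof.
by rewrite /actE (eq_imset _ (fun v => actV1 v)) imset_id.
Qed.

Lemma actEM a b f : actE (a * b)%g f = actE a (actE b f).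
Proof. by rewrite /actE -imset_comp; apply: eq_imset => v; rewrite actVM. Qed.

Lemma actE2 a u w : actE a [set u; w] = [set actV phi a u; actV phi a w].
Proof. by rewrite /actE imsetU1 imset_set1. Qed.

Lemma actE_edges a f : (actE a f \in edges G) = (f \in edges G).
Proof.
suff E b h : h \in edges G -> actE b h \in edges G.
  apply/idP/idP => [|/E //]; rewrite -{2}[f](left_actK actE1 actEM a); exact: E.
move=> hE; have [u [w [_ hE2]]] := edgeP hE.
by have [autE _] := act_aut phi b; rewrite hE2 actE2 autE -hE2.
Qed.

Lemma loop_end_act a l : loop_end (actL phi a l) = actV phi a (loop_end l).
Proof. by have [_] := act_aut phi a. Qed.

Lemma fixes_edgeP a u w :
  actE a [set u; w] = [set u; w] -> fixes_edge phi a u w.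
Proof.
by rewrite actE2 => /set2_eq[]; [left | right].
Qed.

Definition free_symmetry :=
  forall a : gT, a != 1%g ->
    [/\ forall v, ~ fixes_vertex phi a v,
        forall u w, [set u; w] \in edges G -> ~ fixes_edge phi a u w &
        forall l, ~ fixes_loop phi a l].

Hypothesis free : free_symmetry.

Lemma free_vertex a v : actV phi a v = v -> a = 1%g.
Proof. by move=> av; apply/eqP/negPn/negP => /free[/(_ v)]. Qed.

Lemma free_loop a l : actL phi a l = l -> a = 1%g.
Proof. by move=> al; apply/eqP/negPn/negP => /free[_ _ /(_ l)]. Qed.

Lemma free_edge a f : f \in edges G -> actE a f = f -> a = 1%g.
Proof.
move=> fE; have [u [w [uw Ef]]] := edgeP fE; rewrite Ef => Eaf.
apply/eqP/negPn/negP => /free[_ /(_ u w)]; rewrite -Ef => /(_ fE) + _; apply.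
exact: fixes_edgeP.
Qed.
End Symmetry.

(** * Dimension count for twisted fields *)

Section Count.
Variables (F : fieldType) (gT : finGroupType) (G : looped_graph).
Variables (phi : graph_symmetry gT G) (g : gT).
Hypothesis g_gen : generator [set: gT] g.
Variable tau : gT -> 'M[F]_2.
Hypothesis tauM : forall a b, tau (a * b)%g = tau a *m tau b.
Hypothesis tau1 : tau 1%g = 1%:M.
Hypothesis tau_nonscalar : forall a k, a != 1%g -> k *: tau a <> 1%:M.
Hypothesis tau_fixfree :
  forall a (c : 'cV_2), a != 1%g -> tau a *m c = c -> c = 0.
Hypothesis G_sparse : sparse G.
Hypothesis free : free_symmetry phi.

Local Notation V := (vertex G).
Local Notation U := {ffun V -> 'cV[F]_2}.
Local Notation n := #|gT|.

Lemma generatorP (a : gT) : exists k, a = (g ^+ k)%g.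
Proof. by apply/cycleP; rewrite -(eqP g_gen) inE. Qed.

Definition twisted (lam : F) (x : U) :=
  forall v, x (actV phi g v) = lam *: (tau g *m x v).

Lemma twistedX lam x k v : twisted lam x ->
  x (actV phi (g ^+ k)%g v) = lam ^+ k *: (tau (g ^+ k)%g *m x v).
Proof.
move=> tx; elim: k v => [|k IHk] v; first by rewrite actV1 tau1 mul1mx scale1r.
rewrite expgS actVM tx IHk tauM -scalemxAr scalerA mulmxA.
by rewrite exprS.
Qed.

(** [e] contains the adjacency of [E'] and may be larger: the pair version adds all translates of
    one pair on which the fields agree. *)
Variables (e : rel V) (E' : {set {set V}}) (L' : {set loop G}).
Variables (K : {vspace U}) (lam : F).
Hypothesis e_sym : symmetric e.
Hypothesis e_act : forall a u w, e (actV phi a u) (actV phi a w) = e u w.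
Hypothesis E'_edges : E' \subset edges G.
Hypothesis E'_act : forall a f, f \in E' -> actE phi a f \in E'.
Hypothesis E'_e : forall u w, [set u; w] \in E' -> e u w.
Hypothesis K_twisted : forall x, x \in K -> twisted lam x.
Hypothesis K_e : forall x u w, x \in K -> e u w -> x u = x w.
Hypothesis K_loop : forall x l, x \in K -> l \in L' -> x (loop_end l) = 0.

(** Its classes are the connected classes of [e] modulo the group; stepping along [g] both ways
    makes the relation symmetric. *)
Definition linked : rel V :=
  [rel u w | e u w || (w == actV phi g u) || (u == actV phi g w)].

Lemma linked_sym : connect_sym linked.
Proof.
apply: sym_connect_sym => u w; rewrite /linked /= e_sym -!orbA.
by congr (_ || _); rewrite orbC.
Qed.

Lemma linked_act a u w : connect linked u (actV phi a w) = connect linked u w.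
Proof.
have [k ->] := generatorP a; elim: k => [|k IHk]; first by rewrite actV1.
rewrite -IHk expgS actVM; apply/esym/same_connect_r; first exact: linked_sym.
by apply: connect1; rewrite /linked /= eqxx orbT.
Qed.

(** Zeros spread along [e] by equality and along [g] because [tau g] is linear, so one value per
    class determines a field of [K]. *)
Lemma twisted_zero_class x y v :
  x \in K -> x y = 0 -> connect linked y v -> x v = 0.
Proof.
move=> xK xy yv; apply/eqP.
have cl : closed linked [pred v | x v == 0].
  apply: intro_closed; first exact: linked_sym.
  move=> u w /orP[/orP[/(K_e xK)|/eqP->]|/eqP->]; rewrite !inE.
  - by move=> ->.
  - by move=> /eqP xu; rewrite K_twisted // xu mulmx0 scaler0.
  rewrite -{2}[w](actV_K phi g) => /eqP xu.
  (* [g^-1] is itself a power of [g], so [twistedX] also covers backward steps. *)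
  have [k ->] := generatorP g^-1%g.
  by rewrite (twistedX _ _ (K_twisted xK)) xu mulmx0 scaler0.
by have := closed_connect cl yv; rewrite !inE xy eqxx => <-.
Qed.

Section Class.
Variable y : V.

Definition cls : {set V} := [set v | connect linked y v].
Definition clsE : {set {set V}} := [set f in E' | f \subset cls].
Definition clsL : {set loop G} := [set l in L' | loop_end l \in cls].
Definition component : {set V} := [set v | connect e y v].
Definition componentE : {set {set V}} := [set f in E' | f \subset component].
Local Notation delta := (\dim (ev y @: K)).

Lemma y_cls : y \in cls. Proof. by rewrite inE connect0. Qed.
Lemma y_comp : y \in component. Proof. by rewrite inE connect0. Qed.

Lemma cls_act a v : v \in cls -> actV phi a v \in cls.
Proof. by rewrite !inE linked_act. Qed.

Lemma clsE_act a f : f \in clsE -> actE phi a f \in clsE.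
Proof.
rewrite !inE => /andP[fE /subsetP fY]; rewrite E'_act //=; apply/subsetP.
by move=> _ /imsetP[v /fY vY ->]; apply: cls_act.
Qed.

Lemma cls_dvd : (n %| #|cls|)%N.
Proof.
rewrite -cardsT.
apply: (free_action_dvdn (act := fun a => actV phi a) (actV1 phi) (actVM phi)
  (H := [set: gT]%G)).
  by move=> a v _; apply: cls_act.
by move=> a v _ _; apply: free_vertex.
Qed.

Lemma clsE_dvd : (n %| #|clsE|)%N.
Proof.
rewrite -cardsT.
apply: (free_action_dvdn (actE1 phi) (actEM phi) (H := [set: gT]%G)).
  by move=> a v _; apply: clsE_act.
move=> a f _; rewrite inE => /andP[fE _]; apply: free_edge => //.
exact: (subsetP E'_edges).
Qed.

Lemma clsE_lt : (#|clsE| < 2 * #|cls|)%N.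
Proof.
have Y0 : (0 < #|cls|)%N by apply/card_gt0P; exists y; exact: y_cls.
have [->|E0] := eqVneq clsE set0; first by rewrite cards0 muln_gt0.
suff: (#|clsE| + 3 <= 2 * #|cls|)%N by lia.
apply: (G_sparse.2) => //; split=> [|f|l]; last by rewrite inE.
  by apply/subsetP => f; rewrite inE => /andP[/(subsetP E'_edges)].
by rewrite inE => /andP[].
Qed.

(** [n] divides both [#|clsE|] and [#|cls|], so the strict inequality [clsE_lt] leaves a gap of at
    least [n]. *)
Lemma clsE_gap : (#|clsE| + n <= 2 * #|cls|)%N.
Proof.
have := clsE_lt; have /dvdnP[a ->] := cls_dvd; have /dvdnP[b ->] := clsE_dvd.
by rewrite mulnA ltn_mul2r => /andP[_ ab]; rewrite -mulSnr leq_mul2r ab orbT.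
Qed.

Lemma clsEL_le : (#|clsE| + #|clsL| <= 2 * #|cls|)%N.
Proof.
apply: (G_sparse.1); split=> [|f|l].
- by apply/subsetP => f; rewrite inE => /andP[/(subsetP E'_edges)].
- by rewrite inE => /andP[].
by rewrite inE => /andP[].
Qed.

Lemma delta_le2 : (delta <= 2)%N.
Proof.
have := dimvS (subvf (ev y @: K)%VS); rewrite dimvf /dim /=.
by rewrite muln1.
Qed.

(** A loop of [L'] in the class makes every field of [K] vanish at its end, and hence throughout the
    class. *)
Lemma clsL_eq0 : (0 < delta)%N -> clsL = set0.
Proof.
move=> d0; apply/setP => l; rewrite in_set0; apply/negP.
rewrite !inE => /andP[lL yl].
suff : (ev y @: K <= 0)%VS by move/dimvS; rewrite dimv0 leqNgt d0.
apply/subvP => _ /memv_imgP[x xK ->]; rewrite evE memv0; apply/eqP.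
by apply: (twisted_zero_class xK (K_loop xK lL)); rewrite linked_sym.
Qed.

Lemma K_comp x v : x \in K -> v \in component -> x v = x y.
Proof.
move=> xK; rewrite inE => yv; apply/eqP.
have cl : closed e [pred v | x v == x y].
  by move=> u w /(K_e xK) xuw; rewrite !inE xuw.
by have := closed_connect cl yv; rewrite !inE eqxx => <-.
Qed.

Lemma comp_edge f v : f \in E' -> v \in f -> v \in component -> f \subset component.
Proof.
move=> fE vf vX; have [u [w [_ Ef]]] := edgeP (subsetP E'_edges _ fE).
have euw : e u w by apply: E'_e; rewrite -Ef.
have sym := sym_connect_sym e_sym.
have uwX : (u \in component) = (w \in component).
  by rewrite !inE; apply: (same_connect_r sym); apply: connect1.
rewrite Ef subUset !sub1set uwX andbb.
by move: vf vX; rewrite Ef => /set2P[] -> //; rewrite uwX.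
Qed.

Lemma cls_cover v : v \in cls -> exists a w, w \in component /\ v = actV phi a w.
Proof.
rewrite inE => yv.
pose Z := [set actV phi a w | a in [set: gT], w in component].
have ZP u : reflect (exists a w, w \in component /\ u = actV phi a w) (u \in Z).
  apply: (iffP imset2P) => [[a w _ wX ->]|[a [w [wX ->]]]]; first by exists a, w.
  by exists a w.
have cl : closed linked Z.
  apply: intro_closed; first exact: linked_sym.
  move=> u w /orP[/orP[euw|/eqP->]|/eqP->] /ZP[a [z [zX Eu]]]; apply/ZP.
  - exists a, (actV phi a^-1%g w).
    rewrite (actV_VK phi); split=> //.
    move: zX; rewrite !inE => yz; apply: connect_trans yz (connect1 _).
    rewrite -(e_act a) (actV_VK phi).
    by rewrite -Eu.
  - by exists (g * a)%g, z; rewrite Eu actVM.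
  exists (g^-1 * a)%g, z; split=> //; rewrite actVM -Eu.
  by rewrite (actV_K phi).
apply/ZP; rewrite -(closed_connect cl yv); apply/ZP.
by exists 1%g, y; rewrite actV1 y_comp.
Qed.

(** When no nontrivial element maps a vertex of the component into the component, its translates are
    disjoint, and every edge of the class is a translate of an edge inside it. *)
Lemma trivial_stab_count :
    (forall a v, v \in component -> actV phi a v \in component -> a = 1%g) ->
  (n * #|component| <= #|cls|)%N /\ (#|clsE| <= n * #|componentE|)%N.
Proof.
move=> stab; rewrite -cardsT -!cardsX; split.
  rewrite -(@card_in_imset _ _ (fun p : gT * V => actV phi p.1 p.2)).
    apply/subset_leq_card/subsetP => _ /imsetP[[a v] + ->].
    rewrite !inE /= linked_act => yv.
    have sub : subrel e (connect linked).
      by move=> u w euw; apply: connect1; rewrite /linked /= euw.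
    exact: connect_sub sub _ _ yv.
  move=> [a v] [b w] /setXP[/= _ vX] /setXP[/= _ wX] avbw.
  have Ew : w = actV phi (b^-1 * a)%g v.
    by rewrite actVM avbw (actV_K phi).
  have avX : actV phi (b^-1 * a)%g v \in component by rewrite -Ew.
  have /eqP := stab _ _ vX avX.
  rewrite -eq_mulVg1 => /eqP Eab; move: avbw; rewrite Eab => /perm_inj ->.
  by [].
apply: leq_trans (leq_imset_card (fun p : gT * {set V} => actE phi p.1 p.2) _).
apply/subset_leq_card/subsetP => f; rewrite inE => /andP[fE fY].
have [u [w [_ Ef]]] := edgeP (subsetP E'_edges _ fE).
have uf : u \in f by rewrite Ef !inE eqxx.
have [a [v [vX Eu]]] := cls_cover (subsetP fY u uf).
apply/imsetP; exists (a, actE phi a^-1%g f); last first.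
  by rewrite /= (left_actVK (@actE1 _ _ phi) (@actEM _ _ phi)).
rewrite !inE /= E'_act //=; apply: (comp_edge (v := v)) => //; first exact: E'_act.
apply/imsetP; exists u => //.
by rewrite Eu (actV_K phi).
Qed.

(** The slack is 3 if an edge is present; otherwise [m] is limited by twice the number of vertices:
    2 fits a single vertex, 3 needs two. *)
Lemma compE_le m : (m <= 3)%N -> (m <= 2 * #|component|)%N ->
  (#|componentE| + m <= 2 * #|component|)%N.
Proof.
move=> m3 mX; have [->|E0] := eqVneq componentE set0; first by rewrite cards0.
suff: (#|componentE| + 3 <= 2 * #|component|)%N by lia.
apply: (G_sparse.2) => //; split=> [|f|l]; last by rewrite inE.
  by apply/subsetP => f; rewrite inE => /andP[/(subsetP E'_edges)].
by rewrite inE => /andP[].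
Qed.

Lemma class_count : (#|clsE| + #|clsL| + n * delta <= 2 * #|cls|)%N.
Proof.
have [->|d0] := posnP delta; first by rewrite muln0 addn0 clsEL_le.
rewrite (clsL_eq0 d0) cards0 addn0.
have := delta_le2; rewrite leq_eqVlt => /orP[/eqP d2|d1]; last first.
  suff -> : delta = 1%N by rewrite muln1 clsE_gap.
  by apply/eqP; rewrite eqn_leq -ltnS d1.
(* If some [a <> 1] returned a vertex to its component, every field would take the same value at
   both; as these values fill the plane, a multiple of [tau a] would be the identity. *)
have [|nX EX] := trivial_stab_count.
  move=> a v vX avX; apply/eqP/negPn/negP => a1.
  have [k Ea] := generatorP a; apply: (@tau_nonscalar a (lam ^+ k) a1).
  have fullK : (ev y @: K)%VS = fullv.
    by apply/eqP; rewrite eqEdim subvf d2 dimvf /dim /= muln1.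
  have fixc (c : 'cV_2) : lam ^+ k *: tau a *m c = c.
    have : c \in (ev y @: K)%VS by rewrite fullK memvf.
    move=> /memv_imgP[x xK ->]; rewrite evE -{1}(K_comp xK vX) -scalemxAl.
    by rewrite Ea -(twistedX _ _ (K_twisted xK)) -Ea K_comp.
  apply/matrixP => i j; have /matrixP/(_ i 0) := fixc (delta_mx j 0).
  by rewrite -colE !mxE eqxx andbT.
(* Each of the [n] translates contributes slack 2, in total [n * delta]. *)
have : (#|componentE| + 2 <= 2 * #|component|)%N.
  have : (0 < #|component|)%N by apply/card_gt0P; exists y; apply: y_comp.
  by move=> X0; apply: compE_le; lia.
rewrite d2; nia.
Qed.

(** For [lam = 1] any nonzero [delta] already makes the translates disjoint, as [tau a] fixes no
    nonzero vector; the component holds two vertices, so its slack 3 covers [delta] and one more. *)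
Lemma class_count_pair u0 w0 : lam = 1 -> u0 != w0 -> e u0 w0 ->
  u0 \in cls -> (#|clsE| + n + n * delta <= 2 * #|cls|)%N.
Proof.
move=> lam1 uw0 euw0 u0Y.
have [->|d0] := posnP delta; first by rewrite muln0 addn0 clsE_gap.
have [|nX EX] := trivial_stab_count.
  move=> a v vX avX; apply/eqP/negPn/negP => a1.
  have [k Ea] := generatorP a.
  suff : (ev y @: K <= 0)%VS by move/dimvS; rewrite dimv0 leqNgt d0.
  apply/subvP => _ /memv_imgP[x xK ->]; rewrite evE memv0; apply/eqP.
  apply: (@tau_fixfree a _ a1); rewrite -{1}(K_comp xK vX) Ea.
  have := twistedX k v (K_twisted xK); rewrite lam1 expr1n scale1r => <-.
  by rewrite -Ea K_comp.
have X2 : (2 <= #|component|)%N.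
  have [a [u [uX Eu]]] := cls_cover u0Y.
  have uw : u != actV phi a^-1%g w0.
    apply: contra uw0 => /eqP Eu'.
    by rewrite Eu Eu' (actV_VK phi).
  suff : [set u; actV phi a^-1%g w0] \subset component.
    by move/subset_leq_card; rewrite cards2 uw.
  rewrite subUset !sub1set uX; move: uX; rewrite !inE => yu.
  apply: connect_trans yu (connect1 _); rewrite -(e_act a) -Eu.
  by rewrite (actV_VK phi).
have : (#|componentE| + 3 <= 2 * #|component|)%N by apply: compE_le => //; lia.
have := delta_le2; nia.
Qed.
End Class.

Lemma card_sum_roots (T : finType) (A : {set T}) (P : T -> pred V) :
    (forall t, t \in A -> exists v, forall y,
       roots linked y -> P t y = (y == fingraph.root linked v)) ->
  (\sum_(y | roots linked y) #|[set t in A | P t y]| = #|A|)%N.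
Proof.
move=> AP; rewrite -sum1_card.
under eq_bigr do rewrite -sum1dep_card.
rewrite (exchange_big_dep (mem A)) /= => [|y t _ /andP[]//].
apply: eq_bigr => t tA; have [v Pv] := AP t tA.
rewrite (bigD1 (fingraph.root linked v)) /= ?tA ?Pv ?eqxx ?roots_root ?big1 //.
- by move=> y /andP[/andP[ry /andP[_]]]; rewrite Pv // => ->.
- exact: linked_sym.
- exact: linked_sym.
Qed.

Lemma mem_cls y v : roots linked y -> (v \in cls y) = (y == fingraph.root linked v).
Proof.
by move=> /eqP ry; rewrite inE -(root_connect linked_sym) ry.
Qed.

Lemma sum_card_cls : (\sum_(y | roots linked y) #|cls y| = #|V|)%N.
Proof.
rewrite -cardsT -(card_sum_roots (P := fun v y => v \in cls y)).
  by apply: eq_bigr => y _; apply: eq_card => v; rewrite !inE.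
by move=> v _; exists v => y ry; apply: mem_cls.
Qed.

Lemma sum_card_clsE : (\sum_(y | roots linked y) #|clsE y| = #|E'|)%N.
Proof.
rewrite -(card_sum_roots (P := fun (f : {set V}) y => f \subset cls y)) // => f fE.
have [u [w [_ Ef]]] := edgeP (subsetP E'_edges _ fE).
exists u => y ry; rewrite Ef subUset !sub1set !mem_cls //.
suff -> : fingraph.root linked u = fingraph.root linked w by rewrite andbb.
apply/(fingraph.rootP linked_sym)/connect1; rewrite /linked /= E'_e //.
by rewrite -Ef.
Qed.

Lemma sum_card_clsL : (\sum_(y | roots linked y) #|clsL y| = #|L'|)%N.
Proof.
rewrite -(card_sum_roots (P := fun (l : loop G) y => loop_end l \in cls y)) //.
move=> l _.
by exists (loop_end l) => y ry; apply: mem_cls.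
Qed.

Lemma dim_sum_cls : (\dim K <= \sum_(y | roots linked y) \dim (ev y @: K))%N.
Proof.
apply: leq_trans (dim_le_sum_ev (s := enum (roots linked)) _) _; last first.
  by rewrite big_enum.
move=> x xK x0; apply/ffunP => v; rewrite ffunE.
apply: (twisted_zero_class xK (y := fingraph.root linked v)).
  by apply: x0; rewrite mem_enum; apply: (roots_root linked_sym).
by rewrite linked_sym connect_root.
Qed.

Lemma twisted_count : (#|E'| + #|L'| + n * \dim K <= 2 * #|V|)%N.
Proof.
rewrite -sum_card_clsE -sum_card_clsL -sum_card_cls.
have dimK := leq_mul (leqnn n) dim_sum_cls.
apply: leq_trans (leq_add (leqnn _) dimK) _.
rewrite !big_distrr -!big_split /=; apply: leq_sum => y _.
exact: class_count.
Qed.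

(** The class of [u0] supplies the additional [n]; [class_count] handles the others. *)
Lemma twisted_count_pair u0 w0 : lam = 1 -> u0 != w0 -> e u0 w0 ->
  (#|E'| + n + n * \dim K <= 2 * #|V|)%N.
Proof.
move=> lam1 uw0 euw0.
rewrite -sum_card_clsE -sum_card_cls.
have dimK := leq_mul (leqnn n) dim_sum_cls.
apply: leq_trans (leq_add (leqnn _) dimK) _.
have r0 : roots linked (fingraph.root linked u0) by apply: roots_root; apply: linked_sym.
rewrite !(bigD1 (fingraph.root linked u0) r0) /=.
have := class_count_pair lam1 uw0 euw0 (y := fingraph.root linked u0).
rewrite inE linked_sym connect_root => /(_ isT).
set EX := (\sum_(y | _) #|clsE y|)%N; set DX := (\sum_(y | _) \dim _)%N.
set VX := (\sum_(y | _) #|cls y|)%N.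
have : (EX + n * DX <= 2 * VX)%N.
  rewrite !big_distrr -!big_split /=; apply: leq_sum => y _.
  by apply: leq_trans (class_count y); rewrite leq_add2r leq_addr.
rewrite !mulnDr => h1 h2; apply: leq_trans (leq_add h2 h1); apply: eq_leq.
by rewrite [RHS]addnACA; congr (_ + _)%N; rewrite addnAC.
Qed.

End Count.

(** * Generic edge directions and loop normals *)

Lemma card_preim_sum (S T : finType) (A : {set S + T}) :
  #|A| = (#|[set s | inl s \in A]| + #|[set t | inr t \in A]|)%N.
Proof.
rewrite -!sum1_card big_mkcond big_sumType /=.
by congr (_ + _)%N; rewrite -big_mkcond; apply: eq_bigl => s; rewrite inE.
Qed.

(** Natural slopes are preserved by ring morphisms, so the same directions serve over the reals and
    over the complex numbers. *)
Definition slope_dir (F : fieldType) (t : nat) : 'rV[F]_2 :=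
  \row_j (if j == 0 then 1 else t%:R).

(** A quarter turn of [slope_dir]: it annihilates exactly the multiples of that direction. *)
Definition slope_perp (F : fieldType) (t : nat) : 'rV[F]_2 :=
  \row_j (if j == 0 then - t%:R else 1).

Lemma ord2_inj (F : fieldType) (c : 'cV[F]_2) : c 0 0 = 0 -> c 1 0 = 0 -> c = 0.
Proof.
move=> c0 c1; apply/matrixP => i j; rewrite !ord1 mxE.
case: (unliftP 0 i) => [k|] -> //; rewrite (ord1 k) -[RHS]c1.
by congr (c _ _); apply: val_inj.
Qed.

Lemma slope_dirE (F : fieldType) t (c : 'cV[F]_2) :
  slope_dir F t *m c = (c 0 0 + t%:R * c 1 0)%:M.
Proof.
apply/matrixP => i j; rewrite !ord1 !mxE eqxx mulr1n big_ord_recl big_ord1 !mxE /=.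
by rewrite mul1r; congr (_ + _ * c _ _); apply: val_inj.
Qed.

Lemma slope_perpE (F : fieldType) t (c : 'cV[F]_2) :
  slope_perp F t *m c = (c 1 0 - t%:R * c 0 0)%:M.
Proof.
apply/matrixP => i j; rewrite !ord1 !mxE eqxx mulr1n big_ord_recl big_ord1 !mxE /=.
by rewrite mul1r mulNr addrC; congr (c _ _ + _); apply: val_inj.
Qed.

Lemma scalar_mx1_eq0 (F : fieldType) (a : F) : (a%:M == 0 :> 'M_1) = (a == 0).
Proof.
apply/eqP/eqP => [/matrixP/(_ 0 0)|->]; first by rewrite !mxE mulr1n.
exact: raddf0.
Qed.

(** These are the two conditions that [generic_transversal] puts on the spaces [X k i t]. *)
Lemma slope_kernels (F : numFieldType) (U : vectType F) (h : 'Hom(U, 'cV[F]_2))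
    (D : nat -> 'rV[F]_2) :
    (forall s t (c : 'cV_2), s != t -> D s *m c = 0 -> D t *m c = 0 -> c = 0) ->
  (forall t, lker h <= lker (linfun (mulmx (D t)) \o h)%VF)%VS /\
  (forall s t, s != t ->
    lker (linfun (mulmx (D s)) \o h)%VF :&: lker (linfun (mulmx (D t)) \o h)%VF
      <= lker h)%VS.
Proof.
move=> hD; split=> [t|s t st]; apply/subvP => x.
  by rewrite !memv_ker comp_lfunE lfunE /= => /eqP->; rewrite mulmx0.
rewrite memv_cap !memv_ker !comp_lfunE !lfunE /= => /andP[/eqP xs /eqP xt].
by apply/eqP/(hD s t).
Qed.

Lemma slope_dir_inj (F : numFieldType) s t (c : 'cV[F]_2) :
  s != t -> slope_dir F s *m c = 0 -> slope_dir F t *m c = 0 -> c = 0.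
Proof.
move=> st; rewrite !slope_dirE => /eqP + /eqP.
rewrite !scalar_mx1_eq0 => /eqP cs /eqP ct.
have c1 : c 1 0 = 0.
  apply/eqP; have /eqP : (s%:R - t%:R) * c 1 0 = 0.
    by rewrite -[RHS](subrr 0) -{1}cs -ct mulrBl; ring.
  by rewrite mulf_eq0 subr_eq0 eqr_nat (negPf st).
by apply: (ord2_inj _ c1); rewrite -cs c1 mulr0 addr0.
Qed.

Lemma slope_perp_inj (F : numFieldType) s t (c : 'cV[F]_2) :
  s != t -> slope_perp F s *m c = 0 -> slope_perp F t *m c = 0 -> c = 0.
Proof.
move=> st; rewrite !slope_perpE => /eqP + /eqP.
rewrite !scalar_mx1_eq0 => /eqP cs /eqP ct.
have c0 : c 0 0 = 0.
  apply/eqP; have /eqP : (s%:R - t%:R) * c 0 0 = 0.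
    by rewrite -[RHS](subrr 0) -{1}ct -cs mulrBl; ring.
  by rewrite mulf_eq0 subr_eq0 eqr_nat (negPf st).
by apply: (ord2_inj c0); rewrite -cs c0 mulr0 subr0.
Qed.

(** * Generic choice of slopes *)

Section Generic.
Variables (F : numFieldType) (gT : finGroupType) (G : looped_graph).
Variables (phi : graph_symmetry gT G) (g : gT).
Hypothesis g_gen : generator [set: gT] g.
Variable tau : gT -> 'M[F]_2.
Hypothesis tauM : forall a b, tau (a * b)%g = tau a *m tau b.
Hypothesis tau1 : tau 1%g = 1%:M.
Hypothesis tau_nonscalar : forall a k, a != 1%g -> k *: tau a <> 1%:M.
Hypothesis tau_fixfree :
  forall a (c : 'cV_2), a != 1%g -> tau a *m c = c -> c = 0.
Hypothesis G_tight : tight G.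
Hypothesis free : free_symmetry phi.

Local Notation V := (vertex G).
Local Notation U := {ffun V -> 'cV[F]_2}.
Local Notation n := #|gT|.

Definition twisted_space (lam : F) : {vspace U} :=
  (\bigcap_v lker (ev (actV phi g v) -
    lam *: (linfun (mulmx (tau g)) \o ev v)%VF)%R)%VS.

Lemma mem_twisted_space lam x :
  reflect (twisted phi g tau lam x) (x \in twisted_space lam).
Proof.
apply: (iffP (memv_bigcapP _ _ _)) => [tx v|tx v _].
  have := tx v isT; rewrite memv_ker add_lfunE opp_lfunE scale_lfunE comp_lfunE.
  by rewrite !evE lfunE subr_eq0 => /eqP.
rewrite memv_ker add_lfunE opp_lfunE scale_lfunE comp_lfunE.
by rewrite !evE lfunE subr_eq0 tx.
Qed.

Variables (TV : {set V}) (rV : V -> V) (cV : V -> gT).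
Hypothesis TVP :
  free_transversal (fun a v => actV phi a v) [set: V] TV rV cV.

Lemma card_TV : (n * #|TV| = #|V|)%N.
Proof.
have [_ rP _ _ <- //] := TVP; rewrite -cardsT; apply: eq_card => v.
by rewrite !inE; have [-> _] := rP v (in_setT v).
Qed.

(** Extending values on [TV] equivariantly costs two equations for each vertex outside [TV], out of
    [2 * #|V|] unknowns. *)
Lemma dim_twisted1 : (2 * #|TV| <= \dim (twisted_space 1))%N.
Proof.
pose h v : 'Hom(U, 'cV[F]_2) :=
  ev v - (linfun (mulmx (tau (cV v))) \o ev (rV v))%VF.
have := dim_capv_functionals (mem (~: TV)) h fullv.
rewrite capfv dimvf /dim /= !muln1 => dimU.
have sub : (\bigcap_(v in ~: TV) lker (h v) <= twisted_space 1)%VS.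
  apply/subvP => x /memv_bigcapP xh; apply/mem_twisted_space => v.
  have [_ rP rA rT _] := TVP.
  have xE u : x u = tau (cV u) *m x (rV u).
    have [uT|uT] := boolP (u \in TV).
      by have [-> ->] := rT u uT; rewrite tau1 mul1mx.
    have := xh u; rewrite inE uT => /(_ isT).
    by rewrite memv_ker add_lfunE opp_lfunE comp_lfunE !evE lfunE subr_eq0 => /eqP.
  have [rg cg] := rA g v (in_setT v).
  by rewrite scale1r xE rg cg tauM -mulmxA -xE.
have := leq_trans dimU (leq_add (dimvS sub) (leqnn _)).
rewrite /dim /=; have := cardsC TV; rewrite -(_ : #|mem (~: TV)| = #|~: TV|) //.
set a := #|TV|; set b := #|mem _|; set c := #|V|; set d := \dim _; lia.
Qed.

Variables (TE : {set {set V}}) (rE : {set V} -> {set V}) (cE : {set V} -> gT).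
Hypothesis TEP :
  free_transversal (actE phi) (edges G) TE rE cE.

Variables (TL : {set loop G}) (rL : loop G -> loop G) (cL : loop G -> gT).
Hypothesis TLP :
  free_transversal (fun a l => actL phi a l) [set: loop G] TL rL cL.

Lemma card_TE : (n * #|TE| = #|edges G|)%N.
Proof.
have [_ rP _ _ <- //] := TEP; apply: eq_card => v.
by rewrite !inE andb_idr // => /rP[].
Qed.

Lemma card_TL : (n * #|TL| = #|loop G|)%N.
Proof.
have [_ rP _ _ <- //] := TLP; rewrite -cardsT; apply: eq_card => v.
by rewrite !inE; have [-> _] := rP v (in_setT v).
Qed.

Lemma card_transversals : (#|TE| + #|TL| = 2 * #|TV|)%N.
Proof.
have n_gt0 : (0 < n)%N by apply/card_gt0P; exists 1%g.
apply/eqP; rewrite -(eqn_pmul2l n_gt0) mulnDr mulnCA card_TE card_TL card_TV.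
by rewrite G_tight.2.
Qed.

(** [diff] orients each edge arbitrarily; reversal only changes a sign. *)
Variable diff : {set V} -> 'Hom(U, 'cV[F]_2).
Hypothesis diffP : forall f, f \in edges G ->
  exists u w, f = [set u; w] /\ diff f = ev_sub u w.

Lemma diff_eq0 f u w x :
  f \in edges G -> f = [set u; w] -> diff f x = 0 -> x u = x w.
Proof.
move=> fE Ef; have [a [b [Ef' ->]]] := diffP fE.
rewrite ev_subE => /eqP; rewrite subr_eq0 => /eqP xab.
by have [[<- <-]|[<- <-]] := set2_eq (etrans (esym Ef') Ef).
Qed.

(** Conditions on representatives are spread over whole orbits, where the counts for invariant sets
    apply. *)
Definition orbE (A : {set {set V}}) := [set s in edges G | rE s \in A].
Definition orbL (A : {set loop G}) := [set s in [set: loop G] | rL s \in A].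

Lemma orbE_act A a f : f \in orbE A -> actE phi a f \in orbE A.
Proof.
have [_ _ rA _ _] := TEP.
by rewrite !inE actE_edges => /andP[fE]; have [-> _] := rA a f fE; rewrite fE.
Qed.

Lemma orbE_eq (A : {set {set V}}) lam x u w :
  A \subset TE -> twisted phi g tau lam x ->
  (forall f, f \in A -> diff f x = 0) -> [set u; w] \in orbE A -> x u = x w.
Proof.
move=> AT tx xA; rewrite inE => /andP[fE rA].
have [TE_edges rP _ _ _] := TEP; have [_ Ef] := rP _ fE.
have r_edge := subsetP TE_edges _ (subsetP AT _ rA).
have [a [b [Er _]]] := diffP r_edge.
have xab := diff_eq0 r_edge Er (xA _ rA).
have [k Ek] := generatorP g_gen (cE [set u; w]).
have xE : x (actV phi (cE [set u; w]) a) = x (actV phi (cE [set u; w]) b).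
  by rewrite Ek !(twistedX tauM tau1 _ _ tx) xab.
by move: Ef xE; rewrite Er actE2; move: (cE _) => c /set2_eq[] [-> ->].
Qed.

Lemma orbL_eq (A : {set loop G}) lam x l : twisted phi g tau lam x ->
  (forall f, f \in A -> x (loop_end f) = 0) -> l \in orbL A ->
  x (loop_end l) = 0.
Proof.
move=> tx xA; rewrite inE => /andP[fE rA].
have [_ rP _ _ _] := TLP; have [_ ->] := rP _ fE.
have [k Ek] := generatorP g_gen (cL l).
by rewrite loop_end_act Ek (twistedX tauM tau1 _ _ tx) xA // mulmx0 scaler0.
Qed.

Definition orbit_eval (i : {set V} + loop G) : 'Hom(U, 'cV[F]_2) :=
  match i with inl f => diff f | inr l => ev (loop_end l) end.

Definition edge_indices : {set {set V} + loop G} := inl @: TE.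
Definition all_indices : {set {set V} + loop G} := inl @: TE :|: inr @: TL.

(** After multiplication by [n] this is [twisted_count] for the orbits of [A]. *)
Lemma hall_twisted lam :
  hall all_indices (twisted_space lam) (2 * #|TV|) (fun i => lker (orbit_eval i)).
Proof.
move=> A AJ; set K := (_ :&: _)%VS.
set AE := [set f | inl f \in A]; set AL := [set l | inr l \in A].
have AET : AE \subset TE.
  apply/subsetP => f; rewrite inE => /(subsetP AJ); rewrite inE.
  case/orP => /imsetP[h hT //]; by move=> [->].
have ALT : AL \subset TL.
  apply/subsetP => f; rewrite inE => /(subsetP AJ); rewrite inE.
  case/orP => /imsetP[h hT //]; by move=> [->].
have KP x : x \in K -> twisted phi g tau lam x /\
    forall i, i \in A -> orbit_eval i x = 0.
  rewrite memv_cap => /andP[/mem_twisted_space tx /memv_bigcapP xA].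
  by split=> // i /xA; rewrite memv_ker => /eqP.
have n_gt0 : (0 < n)%N by apply/card_gt0P; exists 1%g.
rewrite -(leq_pmul2l n_gt0) mulnDr card_preim_sum mulnDr.
have [_ _ _ _ cardE] := TEP; have [_ _ _ _ cardL] := TLP.
rewrite -cardE // -cardL // mulnCA card_TV.
apply: (twisted_count g_gen tauM tau1 tau_nonscalar G_tight.1 free
  (e := [rel u w | [set u; w] \in orbE AE]) (E' := orbE AE) (L' := orbL AL)
  (K := K) (lam := lam)).
- by move=> u w; rewrite /= setUC.
- move=> a u w /=; apply/idP/idP => /(orbE_act _); rewrite -actE2 => fA.
    by have := fA a^-1%g; rewrite (left_actK (@actE1 _ _ phi) (@actEM _ _ phi)).
  by have := fA a; rewrite ?actE2.
- by apply/subsetP => f; rewrite inE => /andP[].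
- by move=> a f; apply: orbE_act.
- by [].
- by move=> x /KP[].
- move=> x u w /KP[tx xA]; apply: (orbE_eq AET tx) => f.
  by rewrite inE => /xA.
move=> x l /KP[tx xA]; apply: (orbL_eq tx) => f.
by rewrite inE => /xA; rewrite /= evE.
Qed.

(** The predecessor records the gain of [n] in [twisted_count_pair], divided by [n]. *)
Lemma hall_pair u0 w0 : u0 != w0 ->
  hall edge_indices (twisted_space 1 :&: lker (ev_sub u0 w0))%VS
    (2 * #|TV|).-1 (fun i => lker (orbit_eval i)).
Proof.
move=> uw0 A AJ; set K := (_ :&: _)%VS.
set AE := [set f | inl f \in A].
have AET : AE \subset TE.
  apply/subsetP => f; rewrite inE => /(subsetP AJ).
  by case/imsetP=> h hT [->].
have AL : [set l | inr l \in A] = set0.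
  apply/setP => l; rewrite !inE; apply/negP => /(subsetP AJ).
  by case/imsetP.
have KP x : x \in K -> [/\ twisted phi g tau 1 x, x u0 = x w0 &
    forall i, i \in A -> orbit_eval i x = 0].
  rewrite !memv_cap => /andP[/andP[/mem_twisted_space tx]].
  rewrite memv_ker ev_subE subr_eq0 => /eqP xuw /memv_bigcapP xA.
  split=> // i /xA.
  by rewrite memv_ker => /eqP.
have n_gt0 : (0 < n)%N by apply/card_gt0P; exists 1%g.
suff : (#|A| + \dim K < 2 * #|TV|)%N by case: (2 * #|TV|)%N.
rewrite -(leq_pmul2l n_gt0) mulnS mulnDr card_preim_sum AL cards0 addn0.
have [_ _ _ _ cardE] := TEP.
rewrite -cardE // mulnCA card_TV addnA [(n + _)%N]addnC.
(* All translates of the pair [u0], [w0] are joined as well, which keeps [e] invariant under the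
   group. *)
pose e := [rel u w | ([set u; w] \in orbE AE) ||
  [exists a, [set u; w] == [set actV phi a u0; actV phi a w0]]].
have e_step a u w : e u w -> e (actV phi a u) (actV phi a w).
  case/orP=> [fA|/existsP[b /eqP uwb]]; apply/orP; [left|right].
    by rewrite -actE2; apply: orbE_act.
  by apply/existsP; exists (a * b)%g; rewrite -actE2 uwb actE2 !actVM.
have count := (twisted_count_pair g_gen tauM tau1 tau_nonscalar tau_fixfree G_tight.1
  free (e := e) (E' := orbE AE) (L' := set0) (K := K)
  (lam := 1)).
apply: (count _ _ _ _ _ _ _ _ u0 w0).
- by move=> u w; rewrite /e /= setUC.
- move=> a u w; apply/idP/idP => [/(e_step a^-1%g)|/(e_step a) //].
  by rewrite !(actV_K phi).
- by apply/subsetP => f; rewrite inE => /andP[].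
- by move=> a f; apply: orbE_act.
- by move=> u w uw; rewrite /e /= uw.
- by move=> x /KP[].
- move=> x u w /KP[tx x0 xA] /orP[|/existsP[a /eqP uwa]].
    by apply: (orbE_eq AET tx) => f; rewrite inE => /xA.
  have [k Ek] := generatorP g_gen a.
  have xa : x (actV phi a u0) = x (actV phi a w0).
    by rewrite Ek !(twistedX tauM tau1 _ _ tx) x0.
  by have [[-> ->]|[-> ->]] := set2_eq uwa.
- by move=> x l _; rewrite inE.
- by [].
- by [].
by apply/orP; right; apply/existsP; exists 1%g; rewrite !actV1.
Qed.

Variable w : F.
Hypothesis w_prim : n.-primitive_root w.

Definition line_space (D : nat -> 'rV[F]_2) (i : {set V} + loop G) (t : nat) :
    {vspace U} :=
  lker (linfun (mulmx (D t)) \o orbit_eval i)%VF.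

Lemma mem_line_space D i t x :
  (x \in line_space D i t) = (D t *m orbit_eval i x == 0).
Proof. by rewrite memv_ker comp_lfunE lfunE. Qed.

(** The same slopes serve two systems: [slope_dir] gives the equations of motions, and [slope_perp]
    makes differences of positions parallel to the chosen directions. *)
Lemma generic_slopes : exists t : {set V} + loop G -> nat,
  (forall j x, twisted phi g tau (w ^+ j) x ->
     (forall i, i \in all_indices -> slope_dir F (t i) *m orbit_eval i x = 0) ->
     x = 0) /\
  (forall u0 w0, u0 != w0 -> exists x, [/\ twisted phi g tau 1 x,
     forall f, f \in TE -> slope_perp F (t (inl f)) *m diff f x = 0 &
     x u0 <> x w0]).
Proof.
(* One condition for each of the [n] eigenvalues and one for each pair of vertices; [ks] retains the
   pairs with distinct entries. *)
pose KT := ('I_n + V * V)%type.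
pose ks := [seq k <- enum {: KT} | if k is inr (u0, w0) then u0 != w0 else true].
pose J (k : KT) := if k is inl _ then all_indices else edge_indices.
pose B (k : KT) := match k with
  | inl j => twisted_space (w ^+ j)
  | inr (u0, w0) => (twisted_space 1 :&: lker (ev_sub u0 w0))%VS
  end.
pose c (k : KT) := if k is inl _ then (2 * #|TV|)%N else (2 * #|TV|).-1.
pose X (k : KT) := line_space (if k is inl _ then @slope_dir F else @slope_perp F).
have [k i s|k i s t|k|t ht] := @generic_transversal F U KT ks _ J B c
    (fun _ i => lker (orbit_eval i)) X.
- rewrite /X; case: k => _.
    exact: (slope_kernels _ (@slope_dir_inj F)).1.
  exact: (slope_kernels _ (@slope_perp_inj F)).1.
- rewrite /X; case: k => _.
    exact: (slope_kernels _ (@slope_dir_inj F)).2.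
  exact: (slope_kernels _ (@slope_perp_inj F)).2.
- rewrite mem_filter mem_enum andbT.
  case: k => [j _|[u0 w0] uw0]; [exact: hall_twisted | exact: hall_pair].
exists t; split=> [j x tx xJ|u0 w0 uw0].
  have n_gt0 : (0 < n)%N by apply/card_gt0P; exists 1%g.
  pose j' : 'I_n := Ordinal (ltn_pmod j n_gt0).
  have := ht (inl j'); rewrite mem_filter mem_enum => /(_ isT).
  rewrite /= /J cardsU disjoint_setI0 ?cards0 ?subn0; last first.
    rewrite -setI_eq0; apply/eqP/setP => i; rewrite !inE; apply/negP.
    by case/andP=> /imsetP[? _ ->] /imsetP[].
  rewrite !card_imset; try by move=> ? ? [].
  (* There are as many constraints as the bound allows, so the solution space has dimension 0. *)
  rewrite card_transversals -[X in (_ <= X)%N]addn0 leq_add2l leqn0 dimv_eq0.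
  move=> /eqP K0; apply/eqP; rewrite -memv0 -K0 memv_cap; apply/andP; split.
    by apply/mem_twisted_space; rewrite (prim_expr_mod w_prim).
  by apply/memv_bigcapP => i iJ; rewrite mem_line_space xJ.
have := ht (inr (u0, w0)); rewrite mem_filter mem_enum /= uw0 => /(_ isT).
rewrite /J card_imset => [|? ? []//].
set Z := (\bigcap_(i in _) _)%VS => dimZ.
(* The parallel solutions have dimension at least [2 * #|TV| - #|TE|], which exceeds the bound valid
   once [x u0 = x w0] is imposed; so some solution separates the pair. *)
have dimWZ : (2 * #|TV| <= \dim (twisted_space 1 :&: Z) + #|TE|)%N.
  apply: leq_trans dim_twisted1 _.
  apply: leq_trans (dim_capv_functionals (mem edge_indices)
    (fun i => linfun (mulmx (slope_perp F (t i))) \o orbit_eval i)%VF _) _.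
  rewrite leq_add2l {1}/dim /=.
  rewrite (_ : #|mem edge_indices| = #|edge_indices|) //.
  by rewrite card_imset ?mul1n // => ? ? [].
have /subvPn[x] : ~~ (twisted_space 1 :&: Z <= lker (ev_sub u0 w0))%VS.
  apply/negP => sub; have : (twisted_space 1 :&: Z <=
    twisted_space 1 :&: lker (ev_sub u0 w0) :&: Z)%VS.
    by rewrite !subv_cap capvSl capvSr sub.
  move=> /dimvS; have TV0 : (0 < #|TV|)%N.
    apply/card_gt0P; exists (rV u0).
    by have [_ rP _ _ _] := TVP; have [] := rP u0 (in_setT _).
  move: dimZ dimWZ TV0; set a := #|TV|; set b := #|TE|.
  set d := \dim _; set d' := \dim _; lia.
rewrite memv_cap => /andP[/mem_twisted_space tx /memv_bigcapP xZ] xuw.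
exists x; split=> // [f fT|/eqP].
  by apply/eqP; have := xZ (inl f) (imset_f _ fT); rewrite mem_line_space.
move: xuw; rewrite memv_ker ev_subE subr_eq0.
by move=> /negP xuw; apply: xuw.
Qed.
End Generic.

(** * The rotation representation *)

Section Isostatic.
Variables (R : realType) (G : looped_graph).
Variables (p : vertex G -> 'cV[R]_2) (q : loop G -> 'cV[R]_2).

Lemma flatten_surj (y : 'rV[R]_(#|vertex G| * 2)) :
  exists dp, y = flatten_vertices dp.
Proof.
exists (fun v => (row (enum_rank v) (vec_mx y))^T).
rewrite -[LHS]vec_mxK; congr mxvec; apply/matrixP => i k.
by rewrite !mxE enum_valK.
Qed.

Lemma flatten_eq0 (dp : vertex G -> 'cV[R]_2) :
  flatten_vertices dp = 0 -> forall v, dp v = 0.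
Proof.
move=> /(congr1 vec_mx); rewrite mxvecK linear0 => /matrixP dp0 v.
apply/matrixP => k j; rewrite ord1.
by have := dp0 (enum_rank v) k; rewrite !mxE enum_rankK.
Qed.

(** Independent rows and full column rank make the matrix square; conversely a square matrix with
    zero kernel has both properties. *)
Lemma isostaticP :
  isostatic p q <->
  (#|edges G| + #|loop G| = 2 * #|vertex G|)%N /\
  (forall dp, infinitesimal_motion p q dp -> forall v, dp v = 0).
Proof.
split=> [[rkR freeR]|[cardEL rigid]].
  split=> [|dp /rigidity_matrixP Rdp]; first by rewrite -rkR (eqP freeR).
  have fullR : row_full (rigidity_matrix p q) by rewrite /row_full rkR mulnC.
  have [B BR] := row_fullP fullR.
  apply: flatten_eq0; apply: trmx_inj.
  by rewrite trmx0 -[LHS]mul1mx -BR -mulmxA Rdp mulmx0.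
have : row_free (rigidity_matrix p q)^T.
  rewrite -kermx_eq0 -submx0; apply/rV_subP => y /sub_kermxP yR.
  have [dp Ey] := flatten_surj y.
  suff -> : y = 0 by apply: sub0mx.
  have dp0 : forall v, dp v = 0.
    apply: rigid; apply/rigidity_matrixP; apply: trmx_inj.
    by rewrite trmx_mul trmxK -Ey yR trmx0.
  rewrite Ey; apply: (can_inj vec_mxK); rewrite mxvecK linear0.
  by apply/matrixP => i j; rewrite !mxE dp0 mxE.
rewrite /isostatic /row_free mxrank_tr => /eqP rkR.
by rewrite rkR cardEL mulnC.
Qed.
End Isostatic.

Lemma dotE (R : realType) (x y : 'cV[R]_2) : x^T *m y = (dot x y)%:M.
Proof.
apply/matrixP => i j; rewrite !ord1 !mxE eqxx mulr1n.
by apply: eq_bigr => k _; rewrite mxE.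
Qed.

Lemma mulmx2E (F : fieldType) m n (A : 'M[F]_(m, 2)) (B : 'M[F]_(2, n)) i j :
  (A *m B) i j = A i 0 * B 0 j + A i 1 * B 1 j.
Proof.
rewrite !mxE big_ord_recl big_ord1.
by congr (_ + A _ _ * B _ _); apply: val_inj.
Qed.

Lemma ord2_cases (i : 'I_2) : i = 0 \/ i = 1.
Proof.
by case: (unliftP 0 i) => [k|] ->; [right|left]; rewrite // (ord1 k); apply: val_inj.
Qed.

(** The quantity assumed nonzero is the determinant of [M - 1], and the two identities multiply
    [M - 1] by its adjugate. *)
Lemma rotation_fixfree (F : fieldType) (M : 'M[F]_2) (c : 'cV[F]_2) :
    M 1 1 = M 0 0 -> M 0 1 = - M 1 0 ->
    (M 0 0 - 1) ^+ 2 + M 1 0 ^+ 2 != 0 ->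
  M *m c = c -> c = 0.
Proof.
move=> M11 M01 M_neq0 /matrixP Mc.
have := Mc 0 0; have := Mc 1 0; rewrite !mulmx2E M11 M01 => c1 c0.
have z0 : ((M 0 0 - 1) ^+ 2 + M 1 0 ^+ 2) * c 0 0 = 0.
  transitivity ((M 0 0 - 1) * (M 0 0 * c 0 0 + - M 1 0 * c 1 0 - c 0 0) +
    M 1 0 * (M 1 0 * c 0 0 + M 0 0 * c 1 0 - c 1 0)); first by ring.
  by rewrite c0 c1 !subrr !mulr0 addr0.
have z1 : ((M 0 0 - 1) ^+ 2 + M 1 0 ^+ 2) * c 1 0 = 0.
  transitivity ((M 0 0 - 1) * (M 1 0 * c 0 0 + M 0 0 * c 1 0 - c 1 0) -
    M 1 0 * (M 0 0 * c 0 0 + - M 1 0 * c 1 0 - c 0 0)); first by ring.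
  by rewrite c0 c1 !subrr !mulr0 subr0.
by apply: ord2_inj; apply: (mulfI M_neq0); rewrite ?z0 ?z1 mulr0.
Qed.

Lemma rotation_nonscalar (F : fieldType) (M : 'M[F]_2) (k : F) :
  M 1 0 != 0 -> k *: M <> 1%:M.
Proof.
move=> M10 /matrixP kM; have := kM 1 0; rewrite !mxE /= => /eqP.
rewrite mulf_eq0 (negPf M10) orbF => /eqP k0.
have := kM 0 0; rewrite !mxE k0 mul0r => /esym/eqP.
by rewrite oner_eq0.
Qed.

Lemma rotationD (R : realType) (s t : R) :
  rotation (s + t) = rotation s *m rotation t.
Proof.
apply/matrixP => i j; rewrite mulmx2E !mxE sinD cosD.
by case: (ord2_cases i) => ->; case: (ord2_cases j) => -> /=; ring.
Qed.

Section Representation.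
Variables (R : realType) (n : nat).
Hypothesis n_odd : odd n.
Variables (tau : Zmod n -> 'M[R]_2) (g : Zmod n).
Hypothesis tau_rep : orthogonal_rep tau.
Hypothesis g_gen : generator [set: Zmod n] g.
Hypothesis tau_g : tau g = rotation (2 * pi / n%:R).

Lemma card_Zmod : #|Zmod n| = n.
Proof. by rewrite card_ord prednK // odd_gt0. Qed.

Lemma rep1 : tau 1%g = 1%:M.
Proof.
have [tauT tauM] := tau_rep; have := tauM 1%g 1%g; rewrite mulg1 => t11.
by rewrite -[LHS]mulmx1 -{1}(tauT 1%g) mulmxA -t11 tauT.
Qed.

Lemma generator_pow (a : Zmod n) : exists2 k, (k < n)%N & a = (g ^+ k)%g.
Proof.
have : a \in <[g]>%g by rewrite -(eqP g_gen) inE.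
move=> /cyclePmin[k]; rewrite orderE -(eqP g_gen) cardsT card_Zmod => kn ->.
by exists k.
Qed.

Lemma repX k : tau (g ^+ k)%g = rotation (k%:R * (2 * pi / n%:R)).
Proof.
have [_ tauM] := tau_rep.
elim: k => [|k IHk]; last first.
  rewrite expgS tauM IHk tau_g -rotationD; congr rotation.
  by rewrite -[k.+1%:R]natr1 [RHS]mulrDl mul1r addrC.
rewrite expg0 rep1 mul0r; apply/matrixP => i j; rewrite !mxE sin0 cos0 oppr0.
by rewrite if_same; case: (i == j).
Qed.

(** The angle is no multiple of pi because [n] is odd: it lies between 0 and pi if [2 * k < n], and
    between pi and twice pi otherwise. *)
Lemma sin_rotation_neq0 k : (0 < k < n)%N ->
  sin (k%:R * (2 * pi / n%:R)) != 0 :> R.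
Proof.
move=> /andP[k_gt0 kn]; set t := _ * _.
have n_gt0 : (0 : R) < n%:R by rewrite ltr0n odd_gt0.
have tE : t = (2 * k)%:R / n%:R * pi by rewrite /t natrM; ring.
have pi0 := pi_gt0 R.
have k2n : (2 * k != n)%N by apply: contraTneq n_odd => <-; rewrite oddM.
have [lt2k|gt2k|eq2k] := ltngtP (2 * k)%N n; last by rewrite eq2k eqxx in k2n.
  apply: lt0r_neq0; apply: sin_gt0_pi; rewrite tE; apply/andP; split.
    by rewrite mulr_gt0 // divr_gt0 // ltr0n muln_gt0.
  by rewrite -[ltRHS]mul1r ltr_pM2r // ltr_pdivrMr // mul1r ltr_nat.
rewrite -[t](subrK pi) sinDpi oppr_eq0; apply: lt0r_neq0; apply: sin_gt0_pi.
rewrite tE -{2 4}[pi]mul1r -mulrBl mulr_gt0 //=; last first.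
  by rewrite subr_gt0 ltr_pdivlMr // mul1r ltr_nat.
rewrite -[ltRHS]mul1r ltr_pM2r // ltrBlDr ltr_pdivrMr //.
by rewrite -[1 + 1]/(2%:R) -natrM ltr_nat ltn_mul2l.
Qed.

Lemma rep_shape a : tau a 1 1 = tau a 0 0 /\ tau a 0 1 = - tau a 1 0.
Proof.
by have [k _ ->] := generator_pow a; rewrite repX !mxE /=.
Qed.

Lemma rep_neq0 a : a != 1%g -> tau a 1 0 != 0.
Proof.
have [k kn ->] := generator_pow a; rewrite repX !mxE /= => gk.
apply: sin_rotation_neq0; rewrite kn andbT lt0n.
by apply: contraNneq gk => ->; rewrite expg0.
Qed.

(** The determinant of [tau a - 1] is a positive real, and its image under [f] stays nonzero; this
    carries the statement to complex vectors. *)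
Lemma rep_map_fixfree (F : fieldType) (f : {rmorphism R -> F}) a (c : 'cV_2) :
  a != 1%g -> map_mx f (tau a) *m c = c -> c = 0.
Proof.
move=> /rep_neq0 a1; have [t11 t01] := rep_shape a.
apply: rotation_fixfree; rewrite !mxE ?t11 ?t01 ?rmorphN //.
rewrite -(rmorph1 f) -rmorphB -!rmorphXn -rmorphD fmorph_eq0.
by rewrite paddr_eq0 ?sqr_ge0 // negb_and !sqrf_eq0 a1 orbT.
Qed.

Lemma rep_map_nonscalar (F : fieldType) (f : {rmorphism R -> F}) a k :
  a != 1%g -> k *: map_mx f (tau a) <> 1%:M.
Proof.
by move=> /rep_neq0 a1; apply: rotation_nonscalar; rewrite mxE fmorph_eq0.
Qed.

End Representation.

(** * From generic directions to a framework *)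

Section ComplexParts.
Local Open Scope complex_scope.
Variable R : realType.

Lemma map_Re_mul m n k (A : 'M[R]_(m, n)) (x : 'M[R[i]]_(n, k)) :
  map_mx (@complex.Re R) (map_mx (real_complex R) A *m x) =
  A *m map_mx (@complex.Re R) x.
Proof.
apply/matrixP => i j; rewrite !mxE.
elim/big_rec2: _ => // l _ y _ <-; rewrite !mxE.
by case: (x l j) y => a b [c d] /=; rewrite mul0r subr0.
Qed.

Lemma map_Im_mul m n k (A : 'M[R]_(m, n)) (x : 'M[R[i]]_(n, k)) :
  map_mx (@complex.Im R) (map_mx (real_complex R) A *m x) =
  A *m map_mx (@complex.Im R) x.
Proof.
apply/matrixP => i j; rewrite !mxE.
elim/big_rec2: _ => // l _ y _ <-; rewrite !mxE.
by case: (x l j) y => a b [c d] /=; rewrite mul0r addr0.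
Qed.

Lemma map_ReB m n (x y : 'M[R[i]]_(m, n)) :
  map_mx (@complex.Re R) (x - y) =
  map_mx (@complex.Re R) x - map_mx (@complex.Re R) y.
Proof.
by apply/matrixP => i j; rewrite !mxE; case: (x i j) (y i j) => a b [c d].
Qed.

Lemma map_ImB m n (x y : 'M[R[i]]_(m, n)) :
  map_mx (@complex.Im R) (x - y) =
  map_mx (@complex.Im R) x - map_mx (@complex.Im R) y.
Proof.
by apply/matrixP => i j; rewrite !mxE; case: (x i j) (y i j) => a b [c d].
Qed.

Lemma complex_mxP m n (x y : 'M[R[i]]_(m, n)) :
  map_mx (@complex.Re R) x = map_mx (@complex.Re R) y ->
  map_mx (@complex.Im R) x = map_mx (@complex.Im R) y -> x = y.
Proof.
move=> /matrixP re /matrixP im; apply/matrixP => i j.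
move: (re i j) (im i j); rewrite !mxE.
by case: (x i j) (y i j) => a b [c d] /= -> ->.
Qed.
End ComplexParts.

(** * Injective combinations of solutions *)

Section Separating.
Variables (R : numFieldType) (V : finType) (Q : {ffun V -> 'cV[R]_2} -> Prop).
Hypothesis QD : forall x y a, Q x -> Q y -> Q (x + a *: y).

(** Pairs are separated one at a time: [x] already separates those in [s], [y] separates the new
    pair, and [y + m%:R *: x] does both for large [m]. *)
Lemma injective_solution (x0 : {ffun V -> 'cV[R]_2}) :
    Q x0 ->
    (forall u w, u != w -> exists x, Q x /\ x u <> x w) ->
  exists x, Q x /\ injective x.
Proof.
move=> Qx0 sep.
suff [x [Qx xs]] : exists x, Q x /\
    forall uw, uw \in enum [pred uw : V * V | uw.1 != uw.2] -> x uw.1 <> x uw.2.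
  exists x; split=> // u w xuw; apply/eqP; apply: contra_eqT xuw => uw.
  by apply/eqP; apply: (xs (u, w)); rewrite mem_enum.
have : all (fun uw => uw.1 != uw.2) (enum [pred uw : V * V | uw.1 != uw.2]).
  by apply/allP => uw; rewrite mem_enum.
elim: (enum _) => [_|[u w] s IHs /= /andP[uw /IHs[x [Qx xs]]]].
  by exists x0.
have [y [Qy yuw]] := sep u w uw.
pose bad (p : V * V) m := (y + m%:R *: x) p.1 = (y + m%:R *: x) p.2.
have lin a b m : bad (a, b) m -> y a - y b = - (m%:R *: (x a - x b)).
  rewrite /bad /= !ffunE => /eqP; rewrite -subr_eq0 opprD addrACA -scalerBr.
  by rewrite addr_eq0 => /eqP.
(* Equality at [(a, b)] for two values of [m] would force both [x a = x b] and [y a = y b]. *)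
have [[a b] abs i j /lin bi /lin bj|N good] := @eventually_avoid _ ((u, w) :: s) bad.
  apply/eqP; apply: contra_notT (_ : ~ (y a = y b /\ x a = x b)) => [ij|[yab xab]].
    have xab : x a = x b.
      apply/eqP; rewrite -subr_eq0; have /eqP : (i%:R - j%:R) *: (x a - x b) = 0.
        by rewrite scalerBl -[_ *: _]opprK -bi bj opprK subrr.
      by rewrite scaler_eq0 !subr_eq0 eqr_nat (negPf ij).
    split=> //; apply/eqP; rewrite -subr_eq0 bi xab subrr scaler0 oppr0.
    exact: eqxx.
  by move: abs; rewrite inE => /predU1P[[ea eb]|/xs //]; apply: yuw; rewrite -ea -eb.
exists (y + N%:R *: x); split; first exact: QD.
by move=> p ps; apply: (good N (leqnn _) p).
Qed.
End Separating.

Lemma slope_perp_parallel (F : fieldType) (s : nat) (z : 'cV[F]_2) :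
  slope_perp F s *m z = 0 -> z^T = z 0 0 *: slope_dir F s.
Proof.
rewrite slope_perpE => /eqP; rewrite scalar_mx1_eq0 subr_eq0 => /eqP z1.
apply/matrixP => a b; rewrite !mxE ord1.
by case: (ord2_cases b) => -> /=; rewrite ?mulr1 // z1 mulrC.
Qed.

(** * Construction of the symmetric framework *)

Section Sufficiency.
Local Open Scope complex_scope.
Variables (R : realType) (n : nat).
Hypothesis n_odd : odd n.
Variables (tau : Zmod n -> 'M[R]_2) (g : Zmod n).
Hypothesis tau_rep : orthogonal_rep tau.
Hypothesis g_gen : generator [set: Zmod n] g.
Hypothesis tau_g : tau g = rotation (2 * pi / n%:R).
Variables (G : looped_graph) (phi : graph_symmetry (Zmod n) G).
Hypothesis G_tight : tight G.
Hypothesis free : free_symmetry phi.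

Local Notation V := (vertex G).
Local Notation C := R[i].
Local Notation toC := (real_complex R).
Local Notation tauC a := (map_mx toC (tau a)).

Lemma edge_diff_exists (F : fieldType) (f : {set V}) :
  exists h : 'Hom({ffun V -> 'cV[F]_2}, 'cV[F]_2), f \in edges G ->
    exists u w, f = [set u; w] /\ h = ev_sub u w.
Proof.
have [fE|_] := boolP (f \in edges G); last by exists 0.
by have [u [w [_ Ef]]] := edgeP fE; exists (ev_sub u w) => _; exists u, w.
Qed.

(** [(tau g)^T] is the inverse of [tau g], so this is the action of the inverse of [g] on fields;
    its eigenvectors are the twisted fields. *)
Definition pullback (x : {ffun V -> 'cV[C]_2}) : {ffun V -> 'cV[C]_2} :=
  [ffun v => (tauC g)^T *m x (actV phi g v)].

Fact pullback_is_linear : linear pullback.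
Proof.
move=> a x y; apply/ffunP => v; rewrite !ffunE mulmxDr.
by rewrite -scalemxAr.
Qed.

HB.instance Definition _ :=
  GRing.isLinear.Build C {ffun V -> 'cV[C]_2} {ffun V -> 'cV[C]_2} *:%R pullback
    pullback_is_linear.

Lemma tauCM a b : tauC (a * b)%g = tauC a *m tauC b.
Proof. by rewrite tau_rep.2 map_mxM. Qed.

Lemma tauC1 : tauC 1%g = 1%:M.
Proof. by rewrite (rep1 tau_rep) map_mx1. Qed.

Lemma iter_pullback k x v :
  iter k pullback x v = (tauC (g ^+ k)%g)^T *m x (actV phi (g ^+ k)%g v).
Proof.
elim: k v => [|k IHk] v; first by rewrite tauC1 trmx1 mul1mx actV1.
rewrite iterS ffunE IHk mulmxA -trmx_mul -tauCM -expgSr -actVM.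
by rewrite -expgSr.
Qed.

Lemma pullback_order x : iter #|Zmod n| pullback x = x.
Proof.
apply/ffunP => v; rewrite iter_pullback.
rewrite -cardsT (eqP g_gen) -orderE expg_order tauC1 trmx1 mul1mx.
by rewrite actV1.
Qed.

Lemma pullback_eigen lam x : pullback x = lam *: x ->
  twisted phi g (fun a => tauC a) lam x.
Proof.
move=> /ffunP Tx v; have := Tx v; rewrite !ffunE => /(congr1 (mulmx (tauC g))).
rewrite mulmxA map_trmx -map_mxM tau_rep.1 map_mx1 mul1mx => ->.
by rewrite -scalemxAr.
Qed.

Lemma tight_isostatic : symmetric_isostatic tau phi.
Proof.
have [TV [rV [cV TVP]]] := @free_action_transversal _ _ (fun a v => actV phi a v)
  (@actV1 _ _ phi) (@actVM _ _ phi) [set: V] (fun _ _ _ => in_setT _)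
  (fun a s _ => @free_vertex _ _ phi free a s).
have [TE [rE [cE TEP]]] := @free_action_transversal _ _ (actE phi)
  (@actE1 _ _ phi) (@actEM _ _ phi) (edges G)
  (fun a f fE => etrans (actE_edges phi a f) fE)
  (fun a s sE => @free_edge _ _ phi free a s sE).
have [TL [rL [cL TLP]]] := @free_action_transversal _ _ (fun a l => actL phi a l)
  (@actL1 _ _ phi) (@actLM _ _ phi) [set: loop G] (fun _ _ _ => in_setT _)
  (fun a s _ => @free_loop _ _ phi free a s).
have [diff diffP] := boolp.choice (@edge_diff_exists C).
have n_gt0 : (0 < #|Zmod n|)%N by apply/card_gt0P; exists 1%g.
have [w w_prim] := @closed_prim_root_exists C _ n_gt0.
have nonscalar := @rep_map_nonscalar R n n_odd tau g tau_rep g_gen tau_g C toC.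
have fixfree := @rep_map_fixfree R n n_odd tau g tau_rep g_gen tau_g C toC.
have [t [t_rigid t_sol]] := generic_slopes g_gen tauCM tauC1 nonscalar fixfree
  G_tight free TVP TEP TLP diffP w_prim.
have diffE f u v (x : {ffun V -> 'cV[C]_2}) (D : 'rV[C]_2) :
    f \in edges G -> f = [set u; v] ->
    (D *m diff f x == 0) = (D *m (x u - x v) == 0).
  move=> fE Ef; have [a [b [Ef' ->]]] := diffP f fE.
  rewrite ev_subE.
  have [[-> ->]//|[-> ->]] := set2_eq (etrans (esym Ef') Ef).
  by rewrite -[x u - x v]opprB mulmxN oppr_eq0.
(* Real equivariant fields whose differences along representative edges are parallel to the chosen
   directions. *)
pose Q (x : {ffun V -> 'cV[R]_2}) :=
  (forall v, x (actV phi g v) = tau g *m x v) /\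
  (forall f u v, f \in TE -> f = [set u; v] ->
     slope_perp R (t (inl f)) *m (x u - x v) = 0).
have QD x y a : Q x -> Q y -> Q (x + a *: y).
  move=> [x1 x2] [y1 y2]; split=> [v|f u v fT Ef]; rewrite !ffunE.
    by rewrite x1 y1 mulmxDr scalemxAr.
  by rewrite opprD addrACA -scalerBr mulmxDr -scalemxAr x2 // y2 // scaler0 addr0.
have TE_edges : TE \subset edges G by have [] := TEP.
have map_perp s : map_mx toC (slope_perp R s) = slope_perp C s.
  by apply/matrixP => i j; rewrite !mxE; case: ifP;
    rewrite ?rmorphN ?rmorph_nat ?rmorph1.
have map_dir s : map_mx toC (slope_dir R s) = slope_dir C s.
  by apply/matrixP => i j; rewrite !mxE; case: ifP; rewrite ?rmorph_nat ?rmorph1.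
(* A complex solution separates [u] and [v] in its real or in its imaginary part, and either part
   solves the same real system. *)
have sep u v : u != v -> exists x, Q x /\ x u <> x v.
  move=> uv; have [x [tx xperp xuv]] := t_sol u v uv.
  have Qx f a b : f \in TE -> f = [set a; b] ->
      map_mx toC (slope_perp R (t (inl f))) *m (x a - x b) = 0.
    move=> fT Ef; apply/eqP; rewrite map_perp -(diffE f a b) //.
      by rewrite xperp.
    exact: (subsetP TE_edges).
  have [xRe|xRe] :=
    eqVneq (map_mx (@complex.Re R) (x u)) (map_mx (@complex.Re R) (x v)).
    exists [ffun v => map_mx (@complex.Im R) (x v)]; split; last first.
      by rewrite !ffunE => xIm; apply: xuv; apply: complex_mxP.
    split=> [v'|f a b fT Ef]; rewrite !ffunE.
      by rewrite tx scale1r map_Im_mul.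
    by rewrite -map_ImB -map_Im_mul (Qx f) //; apply/matrixP => i j; rewrite !mxE.
  exists [ffun v => map_mx (@complex.Re R) (x v)]; split; last first.
    by rewrite !ffunE; apply/eqP.
  split=> [v'|f a b fT Ef]; rewrite !ffunE.
    by rewrite tx scale1r map_Re_mul.
  by rewrite -map_ReB -map_Re_mul (Qx f) //; apply/matrixP => i j; rewrite !mxE.
have Q0 : Q 0.
  by split=> [v|f u v _ _]; rewrite !ffunE ?subrr mulmx0.
have [p [[p_sym p_perp] p_inj]] := injective_solution QD Q0 sep.
(* The normal of a representative loop is its chosen direction; equivariance dictates the others. *)
pose q l := tau (cL l) *m (slope_dir R (t (inr (rL l))))^T.
have tauM := tau_rep.2; have tau1 := rep1 tau_rep.
have p_symA a v : tau a *m p v = p (actV phi a v).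
  have [k ->] := generatorP g_gen a; elim: k v => [|k IHk] v.
    by rewrite tau1 mul1mx actV1.
  by rewrite expgS tauM actVM p_sym -mulmxA IHk.
have q_sym a l : tau a *m q l = q (actL phi a l).
  have [_ _ rA _ _] := TLP; have [rl cl] := rA a l (in_setT l).
  by rewrite /q rl cl tauM mulmxA.
exists p, q; split=> //.
  (* A loop is fixed by the identity alone, which is no half-turn and satisfies the reflection
     clause trivially. *)
  split=> // [a l half al|a l _ al].
    by rewrite (free_loop free al) in half; move: half;
       rewrite /is_half_turn tau1 => /matrixP/(_ 0 0); rewrite !mxE /= => /eqP;
       rewrite -subr_eq0 opprK -mulr2n pnatr_eq0.
  by left; rewrite (free_loop free al) tau1 mul1mx.
apply/isostaticP; split; first exact: G_tight.2.
move=> dp [dpE dpL] v0; apply/eqP/negPn/negP => dpv0.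
pose x : {ffun V -> 'cV[C]_2} := [ffun v => map_mx toC (dp v)].
(* Complex motions form a space stable under [pullback], since [p] and [q] are equivariant; a
   nonzero real motion yields an eigenvector in it. *)
pose P (y : {ffun V -> 'cV[C]_2}) :=
  (forall u v, [set u; v] \in edges G ->
     (map_mx toC (p u - p v))^T *m (y u - y v) = 0) /\
  (forall l, (map_mx toC (q l))^T *m y (loop_end l) = 0).
have [|||||j [y [[yE yL] y0 Ty]]] := @eigenvector_exists C _ w _ pullback P x w_prim.
- move=> y z a [y1 y2] [z1 z2]; split=> [u v uv|l]; rewrite !ffunE.
    by rewrite opprD addrACA -scalerBr mulmxDr -scalemxAr y1 // z1 // scaler0 addr0.
  by rewrite mulmxDr -scalemxAr y2 z2 scaler0 addr0.
- move=> y [y1 y2]; split=> [u v uv|l]; rewrite !ffunE.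
    rewrite -mulmxBr mulmxA -trmx_mul -map_mxM (mulmxBr (tau g)) !p_symA y1 //.
    by have [autE _] := act_aut phi g; rewrite autE.
  by rewrite mulmxA -trmx_mul -map_mxM q_sym -loop_end_act y2.
- exact: pullback_order.
- split=> [u v uv|l]; rewrite !ffunE.
    by rewrite map_trmx -map_mxB -map_mxM dotE dpE // raddf0 map_mx0.
  by rewrite map_trmx -map_mxM dotE dpL raddf0 map_mx0.
- apply: contra dpv0 => /eqP/ffunP/(_ v0); rewrite !ffunE => /eqP.
  by rewrite map_mx_eq0.
apply/negP: y0; rewrite negbK; apply/eqP; apply: (t_rigid j).
  exact: pullback_eigen.
move=> i; rewrite inE => /orP[]/imsetP[].
  move=> f fT -> /=; have fE := subsetP TE_edges f fT.
  have [u [v [uv Ef]]] := edgeP fE.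
  apply/eqP; rewrite (diffE f u v) //; apply/eqP.
  have := p_perp f u v fT Ef; have := yE u v; rewrite -Ef => /(_ fE).
  set z := p u - p v; set d := y u - y v; set s := t _ => zd /slope_perp_parallel zE.
  (* As [p] is injective, [p u - p v] is a nonzero multiple of the chosen direction, so the motion
     equation is the one for [slope_dir]. *)
  have z00 : z 0 0 != 0.
    apply: contra uv => /eqP z0; apply/eqP/p_inj/eqP; rewrite -subr_eq0.
    by apply/eqP/trmx_inj; rewrite -/z zE z0 scale0r trmx0.
  move: zd; rewrite map_trmx zE map_mxZ map_dir -scalemxAl => /eqP.
  by rewrite scaler_eq0 fmorph_eq0 (negPf z00) => /eqP.
move=> l lT -> /=; rewrite evE -(yL l).
have [_ _ _ rT _] := TLP; have [rl cl] := rT l lT.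
by rewrite /q rl cl tau1 mul1mx map_trmx trmxK map_dir.
Qed.
End Sufficiency.

(** * Isostatic frameworks *)

Section RigidCounts.
Variables (R : realType) (G : looped_graph).
Variables (p : vertex G -> 'cV[R]_2) (q : loop G -> 'cV[R]_2).

Local Notation V := (vertex G).
Local Notation U := {ffun V -> 'cV[R]_2}.

Lemma dot0l (x : 'cV[R]_2) : dot 0 x = 0.
Proof. by rewrite /dot big1 // => k _; rewrite mxE mul0r. Qed.

Lemma dot0r (x : 'cV[R]_2) : dot x 0 = 0.
Proof. by rewrite /dot big1 // => k _; rewrite mxE mulr0. Qed.

Lemma edge_functional_exists (f : {set V}) :
  exists h : 'Hom(U, 'cV[R]_1), f \in edges G -> forall u w x, f = [set u; w] ->
    (h x == 0) = (dot (p u - p w) (x u - x w) == 0).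
Proof.
have [fE|_] := boolP (f \in edges G); last by exists 0.
have [a [b [ab Ef]]] := edgeP fE.
exists (linfun (mulmx (p a - p b)^T) \o (ev_sub a b))%VF => _ u w x Ef'.
rewrite comp_lfunE lfunE ev_subE /= dotE scalar_mx1_eq0.
have [[-> ->]//|[-> ->]] := set2_eq (etrans (esym Ef) Ef').
rewrite -[p u - _]opprB -[x u - _]opprB; congr (_ == 0).
by apply: eq_bigr => k _; rewrite !mxE mulrNN.
Qed.

Hypothesis p_inj : injective p.
Hypothesis cardEL : (#|edges G| + #|loop G| = 2 * #|V|)%N.
Hypothesis rigid :
  forall dp, infinitesimal_motion p q dp -> forall v, dp v = 0.

(** The rows of [E'] and [L'] vanish on [P], so the remaining rows alone must cut [P] down to
    zero. *)
Lemma rigid_dim_bound (P : {vspace U}) (E' : {set {set V}}) (L' : {set loop G}) :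
    E' \subset edges G ->
    (forall x u w, x \in P -> [set u; w] \in E' ->
       dot (p u - p w) (x u - x w) = 0) ->
    (forall x l, x \in P -> l \in L' -> dot (q l) (x (loop_end l)) = 0) ->
  (\dim P + #|E'| + #|L'| <= 2 * #|V|)%N.
Proof.
move=> E'E PE PL.
have [hE hEP] := boolp.choice edge_functional_exists.
pose hL l : 'Hom(U, 'cV[R]_1) := (linfun (mulmx (q l)^T) \o ev (loop_end l))%VF.
pose D := edges G :\: E'.
pose P1 := (P :&: \bigcap_(f in D) lker (hE f))%VS.
have dimP := dim_capv_functionals (mem D) hE P.
have dimP1 := dim_capv_functionals (mem (~: L')) hL P1.
have P2 : (P1 :&: \bigcap_(l in mem (~: L')) lker (hL l) = 0)%VS.
  apply/eqP; rewrite -subv0; apply/subvP => x; rewrite !memv_cap.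
  move=> /andP[/andP[xP /memv_bigcapP xE] /memv_bigcapP xL]; rewrite memv0.
  apply/eqP/ffunP => v; rewrite ffunE; apply: rigid => {v}; split=> [u w uw|l].
    have [uwE|uwE] := boolP ([set u; w] \in E'); first exact: PE.
    by apply/eqP; rewrite -(hEP [set u; w]) // -memv_ker xE // inE uwE.
  have [lL|lL] := boolP (l \in L'); first exact: PL.
  apply/eqP; have := xL l; rewrite inE lL => /(_ isT).
  by rewrite memv_ker comp_lfunE lfunE evE /= dotE scalar_mx1_eq0.
move: dimP dimP1; rewrite P2 dimv0 add0n /dim /= !mul1n.
rewrite (_ : #|mem D| = #|D|) // /D.
rewrite (_ : #|mem (~: L')| = #|~: L'|) //.
have := cardsC L'; have := cardsD (edges G) E'; rewrite (setIidPr E'E).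
have := subset_leq_card E'E; rewrite -/P1; move: cardEL.
set a := #|edges G|; set b := #|loop G|; set c := #|V|; set d := #|_ :\: _|.
set e := #|~: _|; set f := #|E'|; set h := #|L'|; set i := \dim P.
set j := \dim P1; lia.
Qed.

Definition vanishing (V' : {set V}) : {vspace U} :=
  (\bigcap_(v in V') lker (ev v))%VS.

Lemma dim_vanishing V' : (2 * #|V| <= \dim (vanishing V') + 2 * #|V'|)%N.
Proof.
have := dim_capv_functionals (mem V') (fun v => ev v) (fullv : {vspace U}).
rewrite capfv dimvf /dim /= (_ : #|mem V'| = #|V'|) // -/(vanishing V').
by rewrite !muln1 mulnC.
Qed.

Lemma mem_vanishing (V' : {set V}) (x : U) :
  reflect (forall v, v \in V' -> x v = 0) (x \in vanishing V').
Proof.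
apply: (iffP (memv_bigcapP _ _ _)) => xV v /xV; rewrite memv_ker evE.
  by move=> /eqP.
by move=> ->.
Qed.

Lemma rigid_sparse : sparse G.
Proof.
split=> [V' E' L' [E'E E'V L'V]|V' E' [E'E E'V _] /set0Pn[f fE']].
  have := @rigid_dim_bound (vanishing V') E' L' E'E.
  have := dim_vanishing V'.
  set a := \dim _; set b := #|E'|; set c := #|L'|; set d := #|V|; set e := #|V'|.
  move=> dimV bound; suff: (a + b + c <= 2 * d)%N by lia.
  apply: bound => [x u w /mem_vanishing x0 /E'V|x l /mem_vanishing x0 /L'V lV].
    by rewrite subUset !sub1set => /andP[uV wV]; rewrite !x0 // subrr dot0r.
  by rewrite x0 // dot0r.
have [u [w [uw Ef]]] := edgeP (subsetP E'E f fE').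
have /andP[uV wV] : (u \in V') && (w \in V').
  by have := E'V f fE'; rewrite Ef subUset !sub1set.
have [hE hEP] := boolp.choice edge_functional_exists.
pose P := (\bigcap_(f in E') lker (hE f))%VS.
have memP (x : U) : reflect (forall a b, [set a; b] \in E' ->
    dot (p a - p b) (x a - x b) = 0) (x \in P).
  apply: (iffP (memv_bigcapP _ _ _)) => [xP a b ab|xP h hE'].
    by apply/eqP; rewrite -(hEP [set a; b]) ?(subsetP E'E) // -memv_ker xP.
  have [a [b [_ Eh]]] := edgeP (subsetP E'E h hE').
  by rewrite memv_ker (hEP h _ a b) ?(subsetP E'E) // xP // -Eh.
have bound : (\dim P + #|E'| + #|@set0 (loop G)| <= 2 * #|V|)%N.
  apply: rigid_dim_bound => // [x a b /memP xP ab|x l _]; first exact: xP.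
  by rewrite inE.
(* Translations belong to [P], so all values occur at [u]. *)
have fullu : (ev u @: P)%VS = fullv.
  apply/eqP; rewrite eqEsubv subvf; apply/subvP => c _; apply/memv_imgP.
  exists [ffun=> c]; last by rewrite evE ffunE.
  by apply/memP => a b _; rewrite !ffunE subrr dot0r.
have dimP1 := limg_ker_dim (ev u) P; rewrite fullu dimvf /dim /= in dimP1.
have dimP2 := limg_ker_dim (ev w) (P :&: lker (ev u))%VS.
have dimw : (0 < \dim (ev w @: (P :&: lker (ev u))))%N.
  rewrite lt0n dimv_eq0; apply/eqP => /vspaceP im0.
  (* [J] is the quarter turn, and [r] below is the infinitesimal rotation about [p u]; it vanishes
     at [u] but not at [w]. *)
  pose J (c : 'cV[R]_2) : 'cV[R]_2 := \col_i (if i == 0 then - c 1 0 else c 0 0).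
  have JB a b : J a - J b = J (a - b).
    by apply/matrixP => i j; rewrite !mxE; case: ifP => _; rewrite ?mxE ?opprD.
  have dotJ c : dot c (J c) = 0.
    by have := mulmx2E c^T (J c) 0 0; rewrite dotE !mxE eqxx mulr1n /= => ->; ring.
  pose r : U := [ffun v => J (p v - p u)].
  have rP : r \in (P :&: lker (ev u))%VS.
    rewrite memv_cap memv_ker evE ffunE subrr; apply/andP; split; last first.
      by apply/eqP/matrixP => i j; rewrite !mxE oppr0 if_same.
    apply/memP => a b _; rewrite !ffunE JB.
    by rewrite opprB addrA subrK dotJ.
  have := im0 (ev w r); rewrite memv_img // memv0 evE ffunE => /esym/eqP/matrixP Jw.
  have pwu : p w - p u = 0.
    apply: ord2_inj; first by have := Jw 1 0; rewrite !mxE.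
    by have := Jw 0 0; rewrite !mxE /= => /eqP; rewrite oppr_eq0 => /eqP.
  by move/eqP: pwu; rewrite subr_eq0 => /eqP/p_inj/eqP; rewrite eq_sym (negPf uw).
(* Evaluating at [u] and then at [w] loses dimensions 2 and at least 1, the source of the 3 in the
   bound. *)
have sub : (vanishing V' <= P :&: lker (ev u) :&: lker (ev w))%VS.
  apply/subvP => x /mem_vanishing x0.
  rewrite !memv_cap !memv_ker !evE !x0 // eqxx !andbT; apply/memP => a b ab.
  have := E'V _ ab; rewrite subUset !sub1set => /andP[aV bV].
  by rewrite !x0 // subrr dot0r.
have := dimvS sub; have := dim_vanishing V'; move: bound; rewrite cards0 addn0.
move: dimP1 dimP2 dimw; rewrite !muln1.
set a := \dim P; set b := #|E'|; set c := \dim _; set d := \dim _; set e := \dim _.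
set h := \dim _; set i := #|V|; set j := #|V'|; lia.
Qed.

(** A zero normal gives a zero row, and [rigid_dim_bound] for the whole space and this loop fails by
    one. *)
Lemma rigid_loop_neq0 l : q l != 0.
Proof.
apply/eqP => ql0.
suff : (\dim (fullv : {vspace U}) + #|@set0 {set V}| + #|[set l]| <= 2 * #|V|)%N.
  by rewrite dimvf /dim /= cards0 cards1 ?muln1 addn0 mulnC addn1 ltnn.
apply: rigid_dim_bound; first exact: sub0set.
  by move=> x u w _; rewrite inE.
by move=> x k _ /set1P->; rewrite ql0 dot0l.
Qed.
End RigidCounts.

(** * Necessity of the symmetry conditions *)

Section Necessity.
Variables (R : realType) (n : nat).
Hypothesis n_odd : odd n.
Variables (tau : Zmod n -> 'M[R]_2) (g : Zmod n).
Hypothesis tau_rep : orthogonal_rep tau.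
Hypothesis g_gen : generator [set: Zmod n] g.
Hypothesis tau_g : tau g = rotation (2 * pi / n%:R).
Variables (G : looped_graph) (phi : graph_symmetry (Zmod n) G).

Lemma odd_order (a : Zmod n) : odd #[a]%g.
Proof.
have : (#[a]%g %| n)%N.
  by rewrite -[X in (_ %| X)%N](card_Zmod n_odd) -cardsT order_dvdG ?inE.
by move=> /dvdn_odd; apply.
Qed.

Lemma rep_fixfree a (c : 'cV[R]_2) : a != 1%g -> tau a *m c = c -> c = 0.
Proof.
have := @rep_map_fixfree R n n_odd tau g tau_rep g_gen tau_g R idfun a c.
by rewrite map_mx_id.
Qed.

Lemma isostatic_tight : symmetric_isostatic tau phi -> Cn_odd_tight phi.
Proof.
move=> [p [q [p_inj [p_sym q_sym _ _] /isostaticP[cardEL rigid]]]].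
have fixed0 a v : a != 1%g -> actV phi a v = v -> p v = 0.
  by move=> a1 av; apply: (rep_fixfree a1); rewrite p_sym av.
have unique_fixed a b v w : a != 1%g -> b != 1%g ->
    actV phi a v = v -> actV phi b w = w -> v = w.
  by move=> a1 b1 av bw; apply: p_inj; rewrite (fixed0 a) // (fixed0 b).
have loop_free a l : a != 1%g -> actL phi a l <> l.
  move=> a1 al; have /eqP := rigid_loop_neq0 cardEL rigid l; apply.
  apply: (rep_fixfree a1); rewrite q_sym ?al // => a2.
  by have := odd_order a; rewrite a2.
have edge_free a u w : a != 1%g -> [set u; w] \in edges G ->
    ~ fixes_edge phi a u w.
  move=> a1 uwE; have uw : u <> w.
    by move=> uw; have := edges_card2 uwE; rewrite uw cards2 eqxx.
  case=> [[au aw]|[au aw]]; apply: uw; first exact: (unique_fixed a a).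
  (* For an edge that [a] reverses, the square of [a] fixes both ends and is nontrivial, as the
     order of [a] is odd. *)
  have aa1 : (a * a)%g != 1%g.
    apply: contra a1; rewrite -[(a * a)%g]/(a ^+ 2)%g -order_dvdn.
    rewrite -order_eq1 => /dvdn_leq => /(_ isT).
    by have := odd_order a; case: #[a]%g => [|[|[|]]].
  by apply: (unique_fixed (a * a)%g (a * a)%g) => //; rewrite actVM ?au ?aw ?au.
split; first by split=> //; apply: (rigid_sparse p_inj cardEL rigid).
move=> a a1; split=> [v av|u w uwE|l]; [|exact: edge_free|exact: loop_free].
have pv : p v = 0 by apply: fixed0 a1 av.
(* The position of [v] is the origin, which every rotation fixes; so [v] is fixed by the whole
   group. *)
have fixv b : actV phi b v = v by apply: p_inj; rewrite -p_sym pv mulmx0.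
have dvdV : (#[a]%g %| #|[set~ v]|)%N.
  rewrite orderE; apply: (free_action_dvdn (act := fun b => actV phi b)
    (@actV1 _ _ phi) (@actVM _ _ phi)) => [b w _|b w bA].
    by rewrite !inE -{2}(fixv b) (inj_eq perm_inj).
  rewrite !inE => wv bw; apply/eqP/negPn/negP => b1; case/eqP: wv.
  exact: (unique_fixed b a).
have dvdE : (#[a]%g %| #|edges G|)%N.
  rewrite orderE; apply: (free_action_dvdn (act := actE phi)
    (@actE1 _ _ phi) (@actEM _ _ phi)) => [b f _ fE|b f _ fE bf].
    by rewrite actE_edges.
  have [u [w [uw Ef]]] := edgeP fE.
  apply/eqP/negPn/negP => b1; rewrite Ef in fE bf.
  by apply: (edge_free b u w b1 fE); apply: fixes_edgeP.
have dvdL : (#[a]%g %| #|[set: loop G]|)%N.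
  rewrite orderE; apply: (free_action_dvdn (act := fun b => actL phi b)
    (@actL1 _ _ phi) (@actLM _ _ phi)) => [b l _ _|b l _ _ bl].
    by rewrite inE.
  by apply/eqP/negPn/negP => b1; apply: (loop_free b l).
(* Modulo the order of [a], the equality [cardEL] leaves only the contribution 2 of [v]. *)
have : (#[a]%g %| 2)%N.
  rewrite -(@dvdn_addr (2 * #|[set~ v]|)) ?dvdn_mull // -mulnSr.
  have -> : (#|[set~ v]|.+1 = #|vertex G|)%N.
    have V_gt0 : (0 < #|vertex G|)%N by apply/card_gt0P; exists v.
    by rewrite cardsC1 prednK.
  by rewrite -cardEL dvdn_add // -cardsT.
move=> /dvdn_leq => /(_ isT); move: a1 (odd_order a); rewrite -order_eq1.
by case: #[a]%g => [|[|[|]]].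
Qed.
End Necessity.

Theorem theorem6p7 (R : realType) (n : nat) (n_odd : odd n)
    (tau : Zmod n -> 'M[R]_2) (tau_rep : orthogonal_rep tau)
    (g : Zmod n) (g_gen : generator [set: Zmod n] g)
    (tau_g : tau g = rotation (2 * pi / n%:R))
    (G : looped_graph) (phi : graph_symmetry (Zmod n) G) :
  symmetric_isostatic tau phi <-> Cn_odd_tight phi.
Proof.
split; first exact: (isostatic_tight n_odd tau_rep g_gen tau_g).
move=> [G_tight free].
exact: (tight_isostatic n_odd tau_rep g_gen tau_g G_tight free).
Qed.
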